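(* All the local linear relations of Lee between chromatic quasi-symmetric functions of Dyck graphs are induced by the product formula of the Kazhdan–Lusztig basis of the Hecke algebra. Precisely, let $(G,G',G'')$ be a Lee triple of Dyck graphs on $\{1,\dots,n\}$ and let $w,w',w''\in\mathfrak{S}_n$ be the $312$-avoiding permutations associated with $G,G',G''$. Then there is an elementary transposition $s$ such that: (i) if the triple is of the first type, then $c_s\,c_{w'}=c_w+q\,c_{w''}$ and $c_{w'}\,c_s=(q+1)\,c_{w'}$; (ii) if the triple is of the second type, then $c_{w'}\,c_s=c_w+q\,c_{w''}$ and $c_s\,c_{w'}=(q+1)\,c_{w'}$. In each case the first identity is the instance of the Kazhdan–Lusztig product formula for $C'_sC'_{w'}$ (resp. $C'_{w'}C'_s$). Taking traces yields the linear relation $$(q+1)\,\mathrm{tr}(c_{w'})=\mathrm{tr}(c_w)+q\,\mathrm{tr}(c_{w''}),$$ that is, $(q+1)X_{G'}=X_G+qX_{G''}$.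
   Context: Dyck graphs. A Dyck graph is a simple graph on $\{1,\dots,n\}$ such that whenever $\{i,j\}$ with $i<j$ is an edge, all $\{i',j'\}$ with $i\le i'<j'\le j$ are edges. Its code sequence is $a=(a_1,\dots,a_n)$, where $a_i$ is the number of edges $\{i,k\}$ with $k>i$; the code sequences are the sequences of nonnegative integers with $a_n=0$ and $a_{i}\ge a_{i-1}-1$ for $2\le i\le n$. The Lehmer code of $\sigma\in\mathfrak{S}_n$ is the sequence of the numbers $\#\{k>i:\sigma_k<\sigma_i\}$, $i=1,\dots,n$. The permutation associated with $G$ is the one whose Lehmer code is the code sequence of $G$; these are exactly the $312$-avoiding permutations. Lee triples. Let $a$ be the code sequence of a Dyck graph $G$. An edge $(i,j)$ is admissible for $a$ if $j=i+a_i$; $i=1$ or $a_{i-1}\le a_i-1$; $a_i\ge2$; and $a_{j-1}=1+a_j$. Then $G'$ is obtained from $G$ by removing the edge $\{i,j\}$ and $G''$ by removing $\{i,j\}$ and $\{i,j-1\}$ (so the code sequences of $G',G''$ are that of $G$ with $a_i$ replaced by $a_i-1$, $a_i-2$). The triples $(G,G',G'')$ obtained in this way are of the first type. The triples of the second type are their mirror images, obtained by applying the relabelling $k\mapsto n+1-k$ of vertices to the three graphs of a triple of the first type. Lee's relations are the relations $(q+1)X_{G'}=X_G+qX_{G''}$ for all these triples, where $X_G=\sum_c q^{\mathrm{asc}_G(c)}x_{c(1)}\cdots x_{c(n)}$ (sum over proper colorings $c:\{1,\dots,n\}\to\{1,2,\dots\}$; $\mathrm{asc}_G(c)$ is the number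 of edges $\{i,j\}$, $i<j$, with $c(i)<c(j)$). Hecke algebra. $H_n(q)$ (over $\mathbb{Q}(q^{1/2})$) is generated by $T_1,\dots,T_{n-1}$ with the braid relations and $(T_i-q)(T_i+1)=0$; $T_w=T_{i_1}\cdots T_{i_\ell}$ for a reduced word of $w=s_{i_1}\cdots s_{i_\ell}$, with $(\sigma\tau)(k)=\sigma(\tau(k))$. For $w\in\mathfrak{S}_n$, $c_w=\sum_{v\le w}T_v$ (Bruhat order); so $c_{s_i}=1+T_i$. The Kazhdan–Lusztig basis is $C'_w=q^{-\ell(w)/2}\sum_{v\le w}P_{v,w}(q)T_v$; for $312$-avoiding $w$, $c_w=q^{\ell(w)/2}C'_w$. Its product formula reads: $C'_sC'_w=C'_{sw}+\sum_{v<w,\,sv<v}\mu(v,w)C'_v$ if $sw>w$ and $C'_sC'_w=(q^{1/2}+q^{-1/2})C'_w$ if $sw<w$, and symmetrically $C'_wC'_s=C'_{ws}+\sum_{v<w,\,vs<v}\mu(v,w)C'_v$ if $ws>w$ and $(q^{1/2}+q^{-1/2})C'_w$ if $ws<w$, where $\mu(v,w)$ is the coefficient of $q^{(\ell(w)-\ell(v)-1)/2}$ in $P_{v,w}(q)$ if $\ell(w)-\ell(v)$ is odd and $0$ otherwise. Trace. The equivariant trace $\mathrm{tr}$ is the linear map from $H_n(q)$ to symmetric functions satisfying $\mathrm{tr}(xy)=\mathrm{tr}(yx)$ and whose value on a product of mutually commuting connected elements $T_iT_{i+1}\cdots T_{i+k-1}$ (on disjoint, non-adjacent sets of indices) is $\theta_{\lambda}=\prod_m\theta_{\lambda_m}$,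 where the parts of the partition $\lambda$ of $n$ are the numbers of factors plus one of these elements, completed by parts $1$, and $\theta_m=h_m((q-1)X)/(q-1)$, $f\mapsto f((q-1)X)$ denoting the substitution $p_k\mapsto(q^k-1)p_k$. It is known that $\mathrm{tr}(c_w)=\omega X_G$ if $w$ is the permutation associated with the Dyck graph $G$ ($\omega$ the usual involution of symmetric functions). *)

(* Defs.v *)
From HB Require Import structures.
From mathcomp Require Import all_boot all_order all_fingroup all_algebra all_field.
From mathcomp Require Import finmap monalg zify ring.

Set Implicit Arguments.
Unset Strict Implicit.
Unset Printing Implicit Defensive.

Import GRing.Theory.
Local Open Scope ring_scope.

Section Permutations.
Variable n : nat.
Implicit Types (s t u v w : 'S_n).

(* (s t)(k) = s(t(k)); the group law of ['S_n] is the opposite one. *)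
Definition pmul s t : 'S_n := (t * s)%g.

Lemma pmulE s t k : pmul s t k = s (t k).
Proof. by rewrite /pmul permM. Qed.

Definition simple_transp s : bool :=
  [exists i : 'I_n, exists j : 'I_n, (j == i.+1 :> nat) && (s == tperm i j)].

Definition inversions w : {set 'I_n * 'I_n} :=
  [set p : 'I_n * 'I_n | (p.1 < p.2)%N && (w p.2 < w p.1)%N].

Definition plen w : nat := #|inversions w|.

Definition lehmer w (i : 'I_n) : nat := #|[set k : 'I_n | (i < k)%N && (w k < w i)%N]|.

(* Bruhat order: the reflexive transitive closure of
   u -> u (i j) whenever this increases the length. *)
Definition bruhat_step u v : bool :=
  [exists i : 'I_n, exists j : 'I_n, (v == pmul u (tperm i j)) && (plen u < plen v)%N].
Definition bruhat_le u v : bool := connect bruhat_step u v.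
Definition bruhat_lt u v : bool := (u != v) && bruhat_le u v.

Lemma simpleP s : reflect (exists i j : 'I_n, j = i.+1 :> nat /\ s = tperm i j)
  (simple_transp s).
Proof.
apply: (iffP existsP) => [[i /existsP[j /andP[/eqP ij /eqP ->]]]|[i [j [ij ->]]]].
  by exists i, j.
by exists i; apply/existsP; exists j; rewrite ij !eqxx.
Qed.

Lemma simpleK s : simple_transp s -> (s * s = 1)%g.
Proof. by case/simpleP=> i [j [_ ->]]; rewrite tperm2. Qed.

Lemma simpleV s : simple_transp s -> (s^-1 = s)%g.
Proof. by case/simpleP=> i [j [_ ->]]; rewrite tpermV. Qed.

Lemma pmulKs s w : simple_transp s -> pmul s (pmul s w) = w.
Proof. by move=> /simpleK ss; rewrite /pmul -mulgA ss mulg1. Qed.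

Lemma pmulsK s w : simple_transp s -> pmul (pmul w s) s = w.
Proof. by move=> /simpleK ss; rewrite /pmul mulgA ss mul1g. Qed.

Lemma plenV w : plen w^-1 = plen w.
Proof.
have le u : (plen u <= plen u^-1)%N.
  pose f (p : 'I_n * 'I_n) := (u p.2, u p.1).
  have finj : injective f.
    by move=> [a b] [c d] [/perm_inj -> /perm_inj ->].
  rewrite /plen -(card_imset (mem (inversions u)) finj); apply/subset_leq_card/subsetP=> p /imsetP[[a b]].
  by rewrite !inE /= => /andP[ab ba] ->; rewrite /= !permK ba ab.
by apply/eqP; rewrite eqn_leq le -{2}[w]invgK le.
Qed.

Lemma tperm_adj_lt (i j a b : 'I_n) : j = i.+1 :> nat -> (a < b)%N ->
  (a, b) != (i, j) -> (tperm i j a < tperm i j b)%N.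
Proof.
move=> ij; rewrite xpair_eqE -!val_eqE /=.
case: tpermP => [->|->|/eqP + /eqP +]; case: tpermP => [->|->|/eqP + /eqP +];
  rewrite -?val_eqE /=; lia.
Qed.

Lemma plen_up_adj (i j : 'I_n) w : j = i.+1 :> nat -> (w i < w j)%N ->
  plen (pmul w (tperm i j)) = (plen w).+1.
Proof.
move=> ij wij; pose t := tperm i j.
pose f (p : 'I_n * 'I_n) := (t p.1, t p.2).
have finj : injective f.
  by move=> [a b] [c d] [/perm_inj -> /perm_inj ->].
have ltij : (i < j)%N by rewrite ij.
have -> : plen (pmul w t) = #|(i, j) |: f @: inversions w|.
  congr #|pred_of_set _|; apply/setP=> -[a b]; rewrite !inE /= !pmulE.
  apply/idP/idP.
    case/andP=> ab wab; case: (eqVneq (a, b) (i, j)) => //= nab.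
    apply/imsetP; exists (t a, t b); rewrite ?inE /= ?tperm_adj_lt //.
    by rewrite /f /= /t !tpermK.
  case/orP=> [/eqP[-> ->]|/imsetP[[c d]]].
    by rewrite ltij tpermL tpermR.
  rewrite !inE /= => /andP[cd wcd] [-> ->]; rewrite !tpermK wcd andbT.
  apply: tperm_adj_lt => //; apply/eqP=> -[ci dj].
  by move: wcd; rewrite ci dj ltnNge (ltnW wij).
rewrite cardsU1 card_imset // /plen -[RHS]add1n; congr (_ + _)%N.
case: imsetP => // -[[c d]]; rewrite !inE /= => /andP[cd _] [ic jd].
have := cd; rewrite -(canLR (tpermK i j) ic) -(canLR (tpermK i j) jd).
by rewrite tpermL tpermR ltnNge ltnW.
Qed.

Lemma plen_adj (i j : 'I_n) w : j = i.+1 :> nat ->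
  (plen (pmul w (tperm i j)) < plen w)%N = (w j < w i)%N.
Proof.
move=> ij; case: (ltngtP (w j) (w i)) => wij.
- have := @plen_up_adj i j (pmul w (tperm i j)) ij; rewrite pmulsK; last first.
    by apply/simpleP; exists i, j.
  by rewrite !pmulE tpermL tpermR => /(_ wij) ->; rewrite ltnSn.
- by rewrite plen_up_adj // ltnNge leqnSn.
- by move/val_inj/perm_inj: wij => ji; move: ij; rewrite ji => /n_Sn.
Qed.

Lemma plen_simple_neq w s : simple_transp s -> plen (pmul w s) != plen w.
Proof.
case/simpleP=> i [j [ij ->]]; case: (ltngtP (w j) (w i)) => wij.
- by rewrite neq_ltn plen_adj // wij.
- by rewrite plen_up_adj // neq_ltn ltnSn orbT.
- by move/val_inj/perm_inj: wij => ji; move: ij; rewrite ji => /n_Sn.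
Qed.

Lemma plen_pmulV s w : plen (pmul s w) = plen (pmul w^-1 s^-1).
Proof. by rewrite -plenV /pmul invMg. Qed.

Lemma plen_adjl (i j : 'I_n) w : j = i.+1 :> nat ->
  (plen (pmul (tperm i j) w) < plen w)%N = (w^-1 j < w^-1 i)%g%N.
Proof. by move=> ij; rewrite plen_pmulV tpermV -[plen w]plenV plen_adj. Qed.

Lemma plen_simple_neql s w : simple_transp s -> plen (pmul s w) != plen w.
Proof. by move=> ss; rewrite plen_pmulV (simpleV ss) -[plen w]plenV plen_simple_neq. Qed.

Lemma no_descent w :
  (forall i j : 'I_n, j = i.+1 :> nat -> (w i < w j)%N) -> w = 1%g.
Proof.
move=> inc; pose r := [rel x y : 'I_n | (x < y)%N].
have trr : transitive r by move=> x y z; apply: ltn_trans.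
have irr : irreflexive r by move=> x; apply: ltnn.
have se : sorted r (enum 'I_n).
  have : sorted ltn (map val (enum 'I_n)) by rewrite val_enum_ord iota_ltn_sorted.
  by rewrite sorted_map.
have sw : sorted r [seq w i | i <- enum 'I_n].
  suff hw : {homo w : x y / r x y} by apply: homo_sorted se.
  move=> a b /= ab; have [k] := ubnP (b - a)%N.
  elim: k b ab => // k IHk b ab ltk.
  have b1 : (b.-1 < n)%N by apply: leq_ltn_trans (leq_pred b) (ltn_ord b).
  have bS : b = (Ordinal b1).+1 :> nat by rewrite /= prednK // (leq_trans _ ab).
  apply: leq_ltn_trans (inc _ _ bS).
  case: (ltngtP a b.-1) => ab1.
  - by apply/ltnW/IHk => //=; lia.
  - by lia.
  - by apply: eq_leq; congr (val (w _)); apply: val_inj.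
have eqs : enum 'I_n = [seq w i | i <- enum 'I_n].
  apply: (irr_sorted_eq trr irr se sw) => x; rewrite mem_enum inE.
  by apply/esym/mapP; exists (w^-1 x)%g; rewrite ?mem_enum ?permKV.
apply/permP=> x; rewrite perm1; have := mem_enum 'I_n x; rewrite inE => /nthP.
case/(_ x)=> k; rewrite size_enum_ord => kn <-.
by rewrite -(nth_map x x) ?size_enum_ord // -eqs.
Qed.

Lemma simple_descent w : w != 1%g ->
  exists2 s, simple_transp s & (plen (pmul s w) < plen w)%N.
Proof.
move=> w1; case: (pickP [pred p : 'I_n * 'I_n | (p.2 == p.1.+1 :> nat) &&
    (w^-1 p.2 < w^-1 p.1)%g%N]) => [[i j] /= /andP[/eqP ij d]|no].
  by exists (tperm i j); [apply/simpleP; exists i, j|rewrite plen_adjl].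
case/eqP: w1; apply: invg_inj; rewrite invg1; apply: no_descent => i j ij.
have := no (i, j); rewrite /= ij eqxx /=; case: ltngtP => //.
by move/val_inj/perm_inj=> ji; move: ij; rewrite ji => /n_Sn.
Qed.

Lemma plen1 : plen 1 = 0%N.
Proof.
apply/eqP; rewrite cards_eq0; apply/eqP/setP=> p; rewrite !inE !perm1.
by case: ltngtP.
Qed.

(* Left and right descents are exchanged only when s w = w t. *)
Lemma descent_comm s t w : simple_transp s -> simple_transp t ->
  pmul s w != pmul w t ->
  (plen (pmul s (pmul w t)) < plen (pmul w t))%N = (plen (pmul s w) < plen w)%N.
Proof.
case/simpleP=> i [j [ij ->]] /simpleP[k [l [kl ->]]] ne.
rewrite !plen_adjl //.
have E x : ((pmul w (tperm k l))^-1 x = tperm k l (w^-1 x))%g.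
  by rewrite /pmul invMg permM tpermV.
rewrite !E; set a := (w^-1 i)%g; set b := (w^-1 j)%g.
have nab : a != b.
  by apply/eqP=> /perm_inj e; move: ij; rewrite e => /n_Sn.
have conj : (pmul (tperm i j) w = pmul w (tperm a b))%g.
  by rewrite /pmul -tpermJ conjgE invgK -!mulgA mulVg mulg1.
have n1 : (a, b) != (k, l).
  by apply: contra ne => /eqP[ea eb]; rewrite conj ea eb.
have n2 : (b, a) != (k, l).
  by apply: contra ne => /eqP[ea eb]; rewrite conj ea eb tpermC.
apply/idP/idP => h.
  case: (ltngtP b a) => // [ab|/val_inj e]; last by rewrite e eqxx in nab.
  by have := tperm_adj_lt kl ab n1; rewrite ltnNge ltnW.
exact: tperm_adj_lt.
Qed.

Lemma descent_commr s t w : simple_transp s -> simple_transp t ->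
  pmul s w != pmul w t ->
  (plen (pmul (pmul s w) t) < plen (pmul s w))%N = (plen (pmul w t) < plen w)%N.
Proof.
move=> ss st ne.
have V u v : plen (pmul u v) = plen (pmul v^-1 u^-1)%g by rewrite plen_pmulV.
have E u v : ((pmul u v)^-1 = pmul v^-1 u^-1)%g by rewrite /pmul invMg.
rewrite !(V _ t) -[plen (pmul s w)]plenV -[plen w]plenV !E !(simpleV st) (simpleV ss).
apply: descent_comm => //; apply: contra ne => /eqP.
by move/(congr1 (fun z => z^-1)%g); rewrite !E !invgK (simpleV st) (simpleV ss) => ->.
Qed.

End Permutations.
(* The Hecke algebra H_n(q) over a field K containing q, built on its standard
   basis: an element is the family of its coordinates on the T_w, and the
   product is determined by T_s T_w = T_{sw} if sw > w and
   T_s T_w = (q - 1) T_w + q T_{sw} if sw < w. The defining relations are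
   hecke_quadratic, hecke_commute and hecke_braid below, and heckeT_reduced
   identifies T_w with the product along any reduced word of w. *)
Definition hecke (K : fieldType) (q : K) (n : nat) := {ffun 'S_n -> K^o}.

Section HeckeAlgebra.
Variables (K : fieldType) (q : K) (n : nat).
Local Notation H := (hecke q n).
Implicit Types (s t u v w : 'S_n).

HB.instance Definition _ := Vector.on H.

Implicit Types (x y z : H).

Definition heckeT w : H := [ffun u => (u == w)%:R].

Definition heckeL s x : H := [ffun w =>
  if (plen (pmul s w) < plen w)%N then x (pmul s w) + (q - 1) * x w
  else q * x (pmul s w)].

Definition heckeR t x : H := [ffun w =>
  if (plen (pmul w t) < plen w)%N then x (pmul w t) + (q - 1) * x w
  else q * x (pmul w t)].

(* Left multiplication by T_w, following a reduced word of w. *)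
Fixpoint heckeLrec (m : nat) w x : H :=
  if m is m'.+1 then
    if [pick s | simple_transp s && (plen (pmul s w) < plen w)%N] is Some s
    then heckeL s (heckeLrec m' (pmul s w) x) else x
  else x.

Definition hecke_mul x y : H := \sum_w x w *: heckeLrec (plen w) w y.

Lemma pmulA s t w : pmul s (pmul t w) = pmul (pmul s t) w.
Proof. by rewrite /pmul mulgA. Qed.

Lemma heckeT_sum x : x = \sum_w x w *: heckeT w.
Proof.
apply/ffunP=> u; rewrite sum_ffunE (bigD1 u) //= big1 => [|w wu].
  by rewrite !ffunE eqxx /= addr0 /GRing.scale /= mulr1.
by rewrite !ffunE eq_sym (negbTE wu) scaler0.
Qed.

Lemma heckeL_linear s : linear (heckeL s).
Proof.
move=> a x y; apply/ffunP=> w; rewrite !ffunE /GRing.scale /=.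
by case: ifP => _; ring.
Qed.

Lemma heckeR_linear s : linear (heckeR s).
Proof.
move=> a x y; apply/ffunP=> w; rewrite !ffunE /GRing.scale /=.
by case: ifP => _; ring.
Qed.

HB.instance Definition _ s := GRing.isLinear.Build K H H _ (heckeL s) (heckeL_linear s).
HB.instance Definition _ s := GRing.isLinear.Build K H H _ (heckeR s) (heckeR_linear s).

Lemma heckeLR s t x : simple_transp s -> simple_transp t ->
  heckeL s (heckeR t x) = heckeR t (heckeL s x).
Proof.
move=> ss st; apply/ffunP=> w; rewrite !ffunE.
have [e|ne] := eqVneq (pmul s w) (pmul w t).
  have e1 : pmul (pmul s w) t = w by rewrite e pmulsK.
  by rewrite -e e1 pmulKs.
rewrite (descent_comm ss st ne) (descent_commr ss st ne) !pmulA.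
by case: ifP => _; case: ifP => _; ring.
Qed.

Lemma heckeLT s w : simple_transp s ->
  heckeL s (heckeT w) =
    if (plen w < plen (pmul s w))%N then heckeT (pmul s w)
    else (q - 1) *: heckeT w + q *: heckeT (pmul s w).
Proof.
move=> ss; have es u : (pmul s u == w) = (u == pmul s w).
  by apply/eqP/eqP=> [<-|->]; rewrite pmulKs.
have nw : (w == pmul s w) = false.
  by apply/eqP=> e; have := plen_simple_neql w ss; rewrite -e eqxx.
apply/ffunP=> u; rewrite [LHS]ffunE ![heckeT w _]ffunE es.
have := plen_simple_neql w ss.
case: (ltngtP (plen w) (plen (pmul s w))) => // lw _.
  rewrite !ffunE.
  have [->|usw] := eqVneq u (pmul s w).
    by rewrite pmulKs // lw eq_sym nw mulr0 addr0.
  have [->|uw] := eqVneq u w; last by rewrite !mulr0 addr0 if_same.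
  by rewrite ltnNge ltnW //= mulr0.
have sE (a : K) (b : K^o) : a *: b = a * b by [].
rewrite !ffunE !sE.
have [->|usw] := eqVneq u (pmul s w).
  by rewrite pmulKs // ltnNge ltnW //= eq_sym nw mulr0 add0r.
have [->|uw] := eqVneq u w; last by rewrite !mulr0 addr0 if_same.
by rewrite lw add0r mulr0 addr0.
Qed.

Lemma heckeRT t w : simple_transp t -> (plen w < plen (pmul w t))%N ->
  heckeR t (heckeT w) = heckeT (pmul w t).
Proof.
move=> st lw; have et u : (pmul u t == w) = (u == pmul w t).
  by apply/eqP/eqP=> [<-|->]; rewrite pmulsK.
apply/ffunP=> u; rewrite !ffunE et.
have [->|usw] := eqVneq u (pmul w t).
  rewrite pmulsK // lw; case: eqP => [e|_]; last by rewrite mulr0 addr0.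
  by move: lw; rewrite e ltnn.
have [->|uw] := eqVneq u w; last by rewrite !mulr0 addr0 if_same.
by rewrite ltnNge ltnW //= mulr0.
Qed.

Lemma heckeLrec_linear m w : linear (heckeLrec m w).
Proof.
elim: m w => [|m IHm] w a x y //=.
by case: pickP => // s _; rewrite IHm linearP.
Qed.

HB.instance Definition _ m w :=
  GRing.isLinear.Build K H H _ (heckeLrec m w) (heckeLrec_linear m w).

Lemma heckeLrecR m w t x : simple_transp t ->
  heckeLrec m w (heckeR t x) = heckeR t (heckeLrec m w x).
Proof.
move=> st; elim: m w => [|m IHm] w //=.
by case: pickP => // s /andP[ss _]; rewrite IHm heckeLR.
Qed.

Lemma heckeLrecT1 w : heckeLrec (plen w) w (heckeT 1%g) = heckeT w.
Proof.
move eqm: (plen w) => m; have : (plen w <= m)%N by rewrite eqm.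
elim: m w {eqm} => [|m IHm] w lw /=.
  have [->//|/simple_descent[s _]] := eqVneq w 1%g.
  by move: lw; rewrite leqn0 => /eqP ->.
case: pickP => [s /andP[ss ls]|no].
  rewrite IHm ?heckeLT ?pmulKs ?ls //.
  by rewrite -ltnS (leq_trans ls).
have [->//|/simple_descent[s ss ls]] := eqVneq w 1%g.
by have := no s; rewrite ss ls.
Qed.

Lemma hecke_mulDl : left_distributive hecke_mul +%R.
Proof.
move=> x y z; rewrite /hecke_mul -big_split; apply: eq_bigr => w _ /=.
by rewrite ffunE scalerDl.
Qed.

Lemma hecke_mulDr : right_distributive hecke_mul +%R.
Proof.
move=> x y z; rewrite /hecke_mul -big_split; apply: eq_bigr => w _ /=.
by rewrite linearD scalerDr.
Qed.

Lemma hecke_scaleAl a x y : a *: hecke_mul x y = hecke_mul (a *: x) y.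
Proof.
rewrite /hecke_mul scaler_sumr; apply: eq_bigr => w _.
by rewrite ffunE -scalerA.
Qed.

Lemma hecke_scaleAr a x y : a *: hecke_mul x y = hecke_mul x (a *: y).
Proof.
rewrite /hecke_mul scaler_sumr; apply: eq_bigr => w _.
by rewrite [heckeLrec _ _ (a *: y)]linearZ /= !scalerA mulrC.
Qed.

Lemma hecke_mulTl w y : hecke_mul (heckeT w) y = heckeLrec (plen w) w y.
Proof.
rewrite /hecke_mul (bigD1 w) //= big1 => [|u uw].
  by rewrite ffunE eqxx scale1r addr0.
by rewrite ffunE (negbTE uw) scale0r.
Qed.

Lemma hecke_mul1x : left_id (heckeT 1%g) hecke_mul.
Proof. by move=> x; rewrite hecke_mulTl plen1. Qed.

Lemma hecke_mulx1 : right_id (heckeT 1%g) hecke_mul.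
Proof.
move=> x; rewrite [RHS]heckeT_sum; apply: eq_bigr => w _.
by rewrite heckeLrecT1.
Qed.

Lemma hecke_mulx0 x : hecke_mul x 0 = 0.
Proof. by rewrite /hecke_mul big1 // => w _; rewrite linear0 scaler0. Qed.

Lemma hecke_mulR t x y : simple_transp t ->
  hecke_mul x (heckeR t y) = heckeR t (hecke_mul x y).
Proof.
move=> st; rewrite /hecke_mul linear_sum; apply: eq_bigr => w _ /=.
by rewrite heckeLrecR // linearZ.
Qed.

Lemma heckeT_ind (P : H -> Prop) :
  P (heckeT 1%g) -> (forall t x, simple_transp t -> P x -> P (heckeR t x)) ->
  forall w, P (heckeT w).
Proof.
move=> P1 PR w; have [m] := ubnP (plen w); elim: m w => // m IHm w lw.
have [->//|w1] := eqVneq w 1%g.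
have [|t st lt] := @simple_descent n (w^-1)%g; first by rewrite invg_eq1.
have {}lt : (plen (pmul w t) < plen w)%N.
  by move: lt; rewrite plen_pmulV invgK (simpleV st) plenV.
rewrite -[w](pmulsK w st) -heckeRT ?pmulsK //.
by apply: PR => //; apply: IHm; apply: leq_trans lt _.
Qed.

Lemma hecke_mulL s x y : simple_transp s ->
  heckeL s (hecke_mul x y) = hecke_mul (heckeL s x) y.
Proof.
move=> ss; suff HT w : heckeL s (hecke_mul x (heckeT w)) = hecke_mul (heckeL s x) (heckeT w).
  rewrite [y]heckeT_sum.
  apply: (big_rec (fun y => heckeL s (hecke_mul x y) = hecke_mul (heckeL s x) y)) => [|w b _ IH].
    by rewrite !hecke_mulx0 linear0.
  rewrite !hecke_mulDr (linearD (heckeL s)) -!hecke_scaleAr (linearZ_LR (heckeL s)).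
  congr (_ *: _ + _); [exact: HT | exact: IH].
apply: (heckeT_ind (P := fun z => heckeL s (hecke_mul x z) = hecke_mul (heckeL s x) z)).
  by rewrite !hecke_mulx1.
move=> t z st IH.
by rewrite !hecke_mulR // heckeLR // IH.
Qed.

Lemma hecke_mulA : associative hecke_mul.
Proof.
move=> x y z; have HL m w : heckeLrec m w (hecke_mul y z) = hecke_mul (heckeLrec m w y) z.
  elim: m w => [|m IHm] w //=.
  by case: pickP => // s /andP[ss _]; rewrite IHm hecke_mulL.
rewrite [LHS]/hecke_mul [hecke_mul x y]/hecke_mul.
apply: (big_rec2 (fun a b => a = hecke_mul b z)) => [|w a b _ IH].
  by rewrite /hecke_mul big1 // => w _; rewrite ffunE scale0r.
by rewrite hecke_mulDl -IH HL hecke_scaleAl.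
Qed.

Lemma hecke_1neq0 : heckeT 1%g != 0.
Proof.
apply/eqP=> /ffunP/(_ 1%g); rewrite !ffunE eqxx; apply/eqP; exact: oner_neq0.
Qed.

HB.instance Definition _ := GRing.Zmodule_isNzRing.Build H
  hecke_mulA hecke_mul1x hecke_mulx1 hecke_mulDl hecke_mulDr hecke_1neq0.
HB.instance Definition _ := GRing.Lmodule_isLalgebra.Build K H hecke_scaleAl.
HB.instance Definition _ := GRing.Lalgebra_isAlgebra.Build K H hecke_scaleAr.
HB.instance Definition _ := Algebra_isFalgebra.Build K H.

Lemma heckeT1 : heckeT 1%g = 1.
Proof. by []. Qed.

Lemma heckeT_mul s w : simple_transp s ->
  heckeT s * heckeT w =
    if (plen w < plen (pmul s w))%N then heckeT (pmul s w)
    else (q - 1) *: heckeT w + q *: heckeT (pmul s w).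
Proof.
move=> ss; rewrite -heckeLT //.
have ->: heckeT s = heckeL s 1.
  rewrite -heckeT1 heckeLT // plen1 lt0n.
  by have := plen_simple_neql 1 ss; rewrite plen1 => ->; rewrite /pmul mul1g.
by rewrite -[LHS](hecke_mulL _ _ ss) -heckeT1 hecke_mul1x.
Qed.

End HeckeAlgebra.

Section HeckeRelations.
Variables (K : fieldType) (q : K) (n : nat).
Local Notation heckeT := (@heckeT K q n).
Implicit Types (s t v w : 'S_n) (ss : seq 'S_n).

Lemma heckeT_up (i j : 'I_n) w : j = i.+1 :> nat -> (w^-1 i < w^-1 j)%g%N ->
  heckeT (tperm i j) * heckeT w = heckeT (pmul (tperm i j) w).
Proof.
move=> ij wij; have st : simple_transp (tperm i j) by apply/simpleP; exists i, j.
rewrite heckeT_mul //; case: ltngtP (plen_simple_neql w st) => // + _.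
by rewrite plen_adjl // ltnNge ltnW.
Qed.

Lemma hecke_quadratic s : simple_transp s ->
  (heckeT s - q%:A) * (heckeT s + 1) = 0.
Proof.
move=> sS; have ss1 : pmul s s = 1%g by rewrite /pmul simpleK.
rewrite mulrDr mulrBl heckeT_mul // ss1 plen1 ltn0 heckeT1.
rewrite !mulr_algl scalerBl scale1r mulr1.
move: (q *: heckeT s) (q *: 1) (heckeT s) => a b c.
by apply/ffunP=> u; rewrite !ffunE; ring.
Qed.

Lemma hecke_commute (i j k l : 'I_n) :
  j = i.+1 :> nat -> l = k.+1 :> nat -> (j < k)%N ->
  heckeT (tperm i j) * heckeT (tperm k l) = heckeT (tperm k l) * heckeT (tperm i j).
Proof.
move=> ij kl jk.
have [ki li kj lj] : [/\ k != i, l != i, k != j & l != j].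
  by rewrite -!val_eqE /=; split; lia.
have [ik il jk' jl] : [/\ i != k, i != l, j != k & j != l].
  by rewrite -!val_eqE /=; split; lia.
rewrite !heckeT_up ?tpermV ?tpermD ?ij ?kl //.
by congr heckeT; rewrite /pmul conjgC tpermJ !tpermD.
Qed.

Lemma hecke_braid (i j k : 'I_n) : j = i.+1 :> nat -> k = j.+1 :> nat ->
  heckeT (tperm i j) * heckeT (tperm j k) * heckeT (tperm i j) =
  heckeT (tperm j k) * heckeT (tperm i j) * heckeT (tperm j k).
Proof.
move=> ij jk.
have /andP[ij' /and5P[ik jk' kj ki ji]] : [&& i != j, i != k, j != k, k != j, k != i & j != i].
  by rewrite -!val_eqE /=; lia.
have V (u v : 'I_n) (x : 'S_n) : ((pmul (tperm u v) x)^-1 = pmul x^-1 (tperm u v))%g.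
  by rewrite /pmul invMg tpermV.
have C (a b c d : 'I_n) : pmul (tperm a b) (pmul (tperm c d) (tperm a b))
    = tperm (tperm a b c) (tperm a b d).
  by rewrite -tpermJ /pmul conjgE tpermV mulgA.
have sk : tperm i j k = k by rewrite tpermD.
have ti : tperm j k i = i by rewrite tpermD.
have ltij : (i < j)%N by rewrite ij.
have ltjk : (j < k)%N by rewrite jk.
have ltik : (i < k)%N by apply: ltn_trans ltij ltjk.
have up1 := @heckeT_up i j _ ij; have up2 := @heckeT_up j k _ jk.
rewrite -!mulrA (up2 (tperm i j)) ?tpermV ?tpermR ?sk // (up1 (tperm j k)) ?tpermV ?tpermL ?ti //.
rewrite up1 ?up2 ?V ?pmulE ?tpermV ?(tpermL, tpermR, sk, ti) //.
by rewrite !C tpermR tpermL sk ti.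
Qed.

Lemma plen_simple_le s w : simple_transp s -> (plen (pmul s w) <= (plen w).+1)%N.
Proof.
case/simpleP=> i [j [ij ->]]; rewrite plen_pmulV tpermV -[plen w]plenV.
case: (ltngtP (w^-1 i)%g (w^-1 j)%g) => wij.
- by rewrite plen_up_adj.
- by rewrite ltnW // ltnW // ltnS plen_adj.
- by move/val_inj/perm_inj: wij => ji; move: ij; rewrite ji => /n_Sn.
Qed.

Lemma plen_word ss : all (@simple_transp n) ss ->
  (plen (foldr (@pmul n) 1%g ss) <= size ss)%N.
Proof.
elim: ss => [|s ss IH] /=; first by rewrite plen1.
by case/andP=> sS /IH le; apply: leq_trans (plen_simple_le _ sS) _.
Qed.

(* T_w = T_{s_1} ... T_{s_l} for every reduced word w = s_1 ... s_l. *)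
Lemma heckeT_reduced ss : all (@simple_transp n) ss ->
  plen (foldr (@pmul n) 1%g ss) = size ss ->
  heckeT (foldr (@pmul n) 1%g ss) = \prod_(s <- ss) heckeT s.
Proof.
elim: ss => [|s ss IH] /=; first by rewrite big_nil heckeT1.
case/andP=> sS allss len; rewrite big_cons.
have len' : plen (foldr (@pmul n) 1%g ss) = size ss.
  apply/eqP; rewrite eqn_leq plen_word // -ltnS -len.
  exact: plen_simple_le.
by rewrite -IH // heckeT_mul // len len' ltnSn.
Qed.

End HeckeRelations.

(* The field Q(q^{1/2}): rational functions in the variable [qh] = q^{1/2}. *)
Definition Fq : fieldType := {fraction {poly rat}}.
Definition qh : Fq := tofrac ('X : {poly rat}).
Definition q : Fq := qh ^+ 2.

Section KazhdanLusztig.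
Variable n : nat.
Implicit Types (s u v w : 'S_n) (P : 'S_n -> 'S_n -> {poly int}).

Definition kl_c w : hecke q n := \sum_(v | bruhat_le v w) heckeT q v.

Definition polyval (p : {poly int}) (a : Fq) : Fq := (map_poly intr p).[a].

(* C'_w, for a family P of candidate Kazhdan-Lusztig polynomials, and its image
   under the bar involution q^{1/2} -> q^{-1/2}, T_v -> (T_{v^-1})^-1. *)
Definition KLC P w : hecke q n :=
  \sum_(v | bruhat_le v w) (qh ^- plen w * polyval (P v w) q) *: heckeT q v.
Definition bar_KLC P w : hecke q n :=
  \sum_(v | bruhat_le v w)
    (qh ^+ plen w * polyval (P v w) q^-1) *: (heckeT q v^-1%g)^-1.

(* The defining property of the Kazhdan-Lusztig polynomials P_{v,w} = P v w;
   the third clause says deg P_{v,w} <= (l(w) - l(v) - 1) / 2. *)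
Definition KL_polynomials P : Prop :=
  [/\ forall w, P w w = 1,
      forall v w, ~~ bruhat_le v w -> P v w = 0,
      forall v w, bruhat_lt v w ->
        ((size (P v w)).-1.*2 + 1 <= plen w - plen v)%N
    & forall w, bar_KLC P w = KLC P w].

Definition KL_mu P v w : int :=
  if odd (plen w - plen v) then (P v w)`_((plen w - plen v).-1./2) else 0.

(* "c_s c_{w'} = c_w + q c_{w''} is the product formula for C'_s C'_{w'}":
   we are in the case s w' > w', with s w' = w, the only v contributing to the
   sum is w'' (with mu = 1), and all c_u involved are q^{l(u)/2} C'_u. *)
Definition KL_instance_left P s w w' w'' : Prop :=
  [/\ bruhat_lt w' (pmul s w') /\ pmul s w' = w,
      bruhat_lt w'' w' /\ bruhat_lt (pmul s w'') w'',
      forall v, bruhat_lt v w' -> bruhat_lt (pmul s v) v ->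
        KL_mu P v w' = (v == w'')%:R,
      KLC P s * KLC P w' = KLC P (pmul s w') +
        \sum_(v | bruhat_lt v w' && bruhat_lt (pmul s v) v)
           (KL_mu P v w')%:~R *: KLC P v
    & forall u, u \in [:: s; w; w'; w''] -> kl_c u = qh ^+ plen u *: KLC P u].

Definition KL_instance_right P s w w' w'' : Prop :=
  [/\ bruhat_lt w' (pmul w' s) /\ pmul w' s = w,
      bruhat_lt w'' w' /\ bruhat_lt (pmul w'' s) w'',
      forall v, bruhat_lt v w' -> bruhat_lt (pmul v s) v ->
        KL_mu P v w' = (v == w'')%:R,
      KLC P w' * KLC P s = KLC P (pmul w' s) +
        \sum_(v | bruhat_lt v w' && bruhat_lt (pmul v s) v)
           (KL_mu P v w')%:~R *: KLC P v
    & forall u, u \in [:: s; w; w'; w''] -> kl_c u = qh ^+ plen u *: KLC P u].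

End KazhdanLusztig.

(* Symmetric functions over Q(q^{1/2}), as the polynomial ring in the power
   sums p_1, p_2, ...; the variable of index k is p_{k+1}. *)
Definition sym := {malg Fq[{cmonom nat}]}.
Definition psum (k : nat) : sym := << ucm k.-1 >>.

(* h_m = \sum_lambda p_lambda / z_lambda over the partitions lambda of m, the
   permutations of cycle type lambda being m! / z_lambda in number. *)
Definition hsym (m : nat) : sym :=
  (m`!%:R : Fq)^-1 *: \sum_(u : 'S_m) \prod_(C in porbits u) psum #|C|.

(* f |-> f((q-1)X), i.e. p_k |-> (q^k - 1) p_k *)
Definition plethysm (f : sym) : sym :=
  \sum_(m <- msupp f)
    f@_m *: \prod_(k <- finsupp m) ((q ^+ k.+1 - 1) *: psum k.+1) ^+ m k.

Definition theta (m : nat) : sym := (q - 1)^-1 *: plethysm (hsym m).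

Section Trace.
Variable n : nat.

(* The elementary transposition exchanging the 0-based positions i and i+1. *)
Definition adj_transp (i : nat) : 'S_n :=
  match insub i, insub i.+1 with
  | Some a, Some b => tperm a b
  | _, _ => 1%g
  end.

(* T_i T_{i+1} ... T_{i+k-1} (0-based), for b = (i, k) *)
Definition connected_elt (b : nat * nat) : hecke q n :=
  \prod_(b.1 <= j < b.1 + b.2) heckeT q (adj_transp j).

Definition separated_blocks (bs : seq (nat * nat)) : bool :=
  all (fun b => (0 < b.2)%N && (b.1 + b.2 < n)%N) bs &&
  pairwise (fun b c => (b.1 + b.2 < c.1)%N || (c.1 + c.2 < b.1)%N) bs.

Definition equivariant_trace (tr : {linear hecke q n -> sym}) : Prop :=
  (forall x y, tr (x * y) = tr (y * x)) /\
  (forall bs, separated_blocks bs ->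
     tr (\prod_(b <- bs) connected_elt b) =
       (\prod_(b <- bs) theta b.2.+1) * theta 1 ^+ (n - \sum_(b <- bs) b.2.+1)).

End Trace.

Section DyckGraphs.
Variable n : nat.
Implicit Types (G : rel 'I_n) (i j : 'I_n).

(* The vertices 1, ..., n are represented by 'I_n, i.e. 0, ..., n - 1. *)
Definition dyck G : Prop :=
  [/\ symmetric G, irreflexive G
    & forall i j i' j', (i < j)%N -> G i j ->
        (i <= i')%N -> (i' < j')%N -> (j' <= j)%N -> G i' j'].

Definition code G i : nat := #|[set k : 'I_n | (i < k)%N && G i k]|.

Definition associated G (w : 'S_n) : Prop := forall i, lehmer w i = code G i.

Definition del_edge G i j : rel 'I_n :=
  fun x y => G x y && ([set x; y] != [set i; j]).

Definition mirror G : rel 'I_n := fun x y => G (rev_ord x) (rev_ord y).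

Definition admissible G i j : Prop :=
  [/\ (i < j)%N && G i j,
      j = (i + code G i)%N :> nat,
      forall i1, i = i1.+1 :> nat -> (code G i1 <= code G i - 1)%N,
      (2 <= code G i)%N
    & forall j1, j = j1.+1 :> nat -> code G j1 = (1 + code G j)%N].

Definition lee_first (G G' G'' : rel 'I_n) : Prop :=
  dyck G /\
  exists i j j1, [/\ admissible G i j, j = j1.+1 :> nat,
    G' =2 del_edge G i j & G'' =2 del_edge (del_edge G i j) i j1].

Definition lee_second (G G' G'' : rel 'I_n) : Prop :=
  exists H H' H'' : rel 'I_n, lee_first H H' H'' /\
    [/\ G =2 mirror H, G' =2 mirror H' & G'' =2 mirror H''].

Definition lee_triple (G G' G'' : rel 'I_n) : Prop :=
  lee_first G G' G'' \/ lee_second G G' G''.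

(* X_G as a formal power series in x_0, x_1, ...: its coefficient at the
   monomial m. Colorings of monomial m only use colors in the support of m. *)
Definition chromatic G (m : {cmonom nat}) : Fq :=
  \sum_(c : {ffun 'I_n -> finsupp m} |
        [forall i, forall j, G i j ==> (c i != c j)] &&
        (\big[mmul/mone]_i ucm (val (c i)) == m))
    q ^+ #|[set p : 'I_n * 'I_n |
             [&& (p.1 < p.2)%N, G p.1 p.2 & (val (c p.1) < val (c p.2))%N]]|.

End DyckGraphs.

(* Main.v *)
(* For a Dyck graph G with associated permutation w, the Bruhat interval below w
   consists of the permutations v such that v k <= k or {k, v k} is an edge, for
   every k. For a Lee triple of the first type with removed edges {i, j} and
   {i, j - 1}, let s exchange the values j - 1 and j. The intervals below w and
   w'' are the unions of the pairs {u, s u} whose shorter, resp. longer, element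
   is below w'; this is the identity c_s c_w' = c_w + q c_w''. Since j - 1 and j have
   the same right neighbours, the interval below w' is stable under right
   multiplication by s. The second type is transported by v |-> w_0 v^-1 w_0.

   The same identity, applied to the first vertex i having a larger neighbour,
   shows by induction on the number of edges that q^{-l(w)/2} c_w is invariant
   under the bar involution; by uniqueness of the Kazhdan-Lusztig polynomials,
   P_{v,w} = 1 for all v <= w, whence mu(v,w') is 1 if l(v) = l(w') - 1 and 0
   otherwise.

   As the identity tr(c_w) = omega X_G is not at hand, the relation between the
   X_G is proved directly: it already holds for the sum of the contributions of
   a coloring and of its composition with the transposition (j - 1, j). *)
Require Import Defs.
From HB Require Import structures.
From mathcomp Require Import all_boot all_order all_fingroup all_algebra all_field.
From mathcomp Require Import finmap monalg zify ring.

Set Implicit Arguments.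
Unset Strict Implicit.
Unset Printing Implicit Defensive.

Import GRing.Theory.
Local Open Scope ring_scope.

(** * Bruhat order and rook boards *)

Section Bruhat.
Variable n : nat.
Implicit Types (i j k : 'I_n) (s u v w : 'S_n).

Lemma pmul_tpermK u i j : pmul (pmul u (tperm i j)) (tperm i j) = u.
Proof. by rewrite /pmul mulgA tperm2 mul1g. Qed.

Lemma plen_adj_le u i j : j = i.+1 :> nat ->
  (plen u <= (plen (pmul u (tperm i j))).+1)%N.
Proof.
move=> ij; case: (ltngtP (u i) (u j)) => uij.
- by rewrite plen_up_adj // ltnW // ltnW.
- rewrite -{1}[u](pmul_tpermK u i j) plen_up_adj //.
  by rewrite !pmulE tpermL tpermR.
- by move/val_inj/perm_inj: uij => ji; move: ij; rewrite ji => /n_Sn.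
Qed.

(** Induction on j - i through (i j) = (k j)(i k)(k j) with k = j - 1. The middle factor lengthens
    by induction; of the two outer adjacent factors one lengthens and the other shortens by at most
    one, according to the order of u k and u j. *)
Lemma plen_tperm u i j : (i < j)%N -> (u i < u j)%N ->
  (plen u < plen (pmul u (tperm i j)))%N.
Proof.
have [m] := ubnP (j - i)%N; elim: m u i j => // m IHm u i j ltm ij uij.
have k_n : (j.-1 < n)%N by apply: leq_ltn_trans (leq_pred j) (ltn_ord j).
pose k := Ordinal k_n; have kj : j = k.+1 :> nat by rewrite /= prednK // (leq_ltn_trans _ ij).
have [ik|ki] := eqVneq i k; first by rewrite plen_up_adj // ik.
have {ki} ik : (i < k)%N by move: ki; rewrite -val_eqE /=; lia.
have /and5P[nik nij nkj njk nki] : [&& i != k, i != j, k != j, j != k & k != i].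
  by rewrite -!val_eqE /=; lia.
pose t := tperm k j; pose u1 := pmul u t; pose u2 := pmul u1 (tperm i k).
have -> : pmul u (tperm i j) = pmul u2 t.
  apply/permP=> x; rewrite !pmulE; congr (u _).
  rewrite /t; case: (tpermP k j x) => [->|->|/eqP xk /eqP xj].
  - by rewrite (tpermD nik njk) (tpermD nij nkj) tpermR.
  - by rewrite !tpermR (tpermD nki _) // eq_sym.
  - case: (eqVneq i x) => [<-|ix]; first by rewrite !tpermL.
    by rewrite !tpermD // eq_sym.
have u2k : u2 k = u i by rewrite !pmulE tpermR tpermD // eq_sym.
have u2j : u2 j = u k by rewrite !pmulE (tpermD nij nkj) tpermR.
have l12 : (plen u1 < plen u2)%N.
  apply: IHm => //; first by rewrite /=; lia.
  by rewrite !pmulE tpermL tpermD // eq_sym.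
case: (ltngtP (u k) (u j)) => ukj.
- have l1 : plen u1 = (plen u).+1 by apply: plen_up_adj.
  by have := plen_adj_le u2 kj; rewrite -/t; lia.
- have l1 := plen_adj_le u kj; rewrite -/t -/u1 in l1.
  have : plen (pmul u2 t) = (plen u2).+1.
    by apply: plen_up_adj => //; rewrite u2k u2j; apply: ltn_trans ukj.
  lia.
- by move/val_inj/perm_inj: ukj nkj => ->; rewrite eqxx.
Qed.

Lemma plen_tpermE u i j : (i < j)%N ->
  (plen u < plen (pmul u (tperm i j)))%N = (u i < u j)%N.
Proof.
move=> ij; case: (ltngtP (u i) (u j)) => uij; first exact: plen_tperm.
  have := @plen_tperm (pmul u (tperm i j)) i j ij.
  by rewrite pmul_tpermK !pmulE tpermL tpermR => /(_ uij); lia.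
by move/val_inj/perm_inj: uij ij => ->; rewrite ltnn.
Qed.

Lemma bruhat_le_refl u : bruhat_le u u.
Proof. exact: connect0. Qed.

Lemma bruhat_stepP u v : reflect
  (exists i j, [/\ (i < j)%N, (u i < u j)%N & v = pmul u (tperm i j)]) (bruhat_step u v).
Proof.
apply: (iffP existsP) => [[i /existsP[j /andP[/eqP -> lt]]]|[i [j [ij uij ->]]]].
  case: (ltngtP i j) => ij.
  - by exists i, j; rewrite -plen_tpermE.
  - by exists j, i; rewrite -plen_tpermE // tpermC.
  - by move: lt; rewrite (val_inj ij) tperm1 /pmul mul1g ltnn.
by exists i; apply/existsP; exists j; rewrite eqxx plen_tperm.
Qed.

Lemma bruhat_le_plen u v : bruhat_le u v -> (u == v) || (plen u < plen v)%N.
Proof.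
case/connectP=> p; elim: p u => [|x p IH] u /=; first by move=> _ ->; rewrite eqxx.
case/andP=> /existsP[i /existsP[j /andP[_ ux]]] /IH{}IH vE.
by have /orP[/eqP <-|/(ltn_trans ux) ->] := IH vE; rewrite ?ux orbT.
Qed.

Lemma bruhat_le_eq u v : bruhat_le u v -> plen u = plen v -> u = v.
Proof. by move=> /bruhat_le_plen /orP[/eqP //|] + e; rewrite e ltnn. Qed.

Lemma bruhat_lt_plen u v : bruhat_lt u v -> (plen u < plen v)%N.
Proof. by case/andP=> /negbTE uv /bruhat_le_plen; rewrite uv. Qed.

Lemma bruhat_le_plenW u v : bruhat_le u v -> (plen u <= plen v)%N.
Proof. by case/bruhat_le_plen/orP=> [/eqP ->|/ltnW]. Qed.

Lemma bruhat_ltE u v : (plen u < plen v)%N -> bruhat_lt u v = bruhat_le u v.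
Proof. by rewrite /bruhat_lt; case: eqP => // ->; rewrite ltnn. Qed.

Lemma bruhat_ltr s u : simple_transp s -> bruhat_lt u (pmul u s) = (plen u < plen (pmul u s))%N.
Proof.
move=> /simpleP[i [j [ij sE]]]; apply/idP/idP => [/bruhat_lt_plen //|lt].
rewrite bruhat_ltE //; apply: connect1; apply/existsP; exists i; apply/existsP; exists j.
by rewrite lt sE eqxx.
Qed.

Lemma bruhat_ltl s u : simple_transp s -> bruhat_lt u (pmul s u) = (plen u < plen (pmul s u))%N.
Proof.
move=> /simpleP[i [j [ij sE]]]; apply/idP/idP => [/bruhat_lt_plen //|lt].
(* Since s u = u (u^-1 s u), multiplying by s on the left is multiplying on the right by the
   transposition of the positions of the values i and j. *)
rewrite bruhat_ltE //; apply: connect1; apply/existsP; exists (u^-1 i)%g; apply/existsP; exists (u^-1 j)%g.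
rewrite lt sE andbT; apply/eqP; rewrite /pmul.
by rewrite -tpermJ conjgE invgK -!mulgA mulVg mulg1.
Qed.

Lemma plen_simple s : simple_transp s -> plen s = 1%N.
Proof.
case/simpleP=> i [j [ij ->]].
by rewrite -[tperm i j]mulg1 -/(pmul 1%g _) plen_up_adj ?plen1 // !perm1 ij.
Qed.

Lemma plen_eq0 u : plen u = 0%N -> u = 1%g.
Proof. by move=> u0; apply/eqP/negPn/negP => /simple_descent[s _]; rewrite u0. Qed.

Lemma bruhat_le_simple s u : simple_transp s -> bruhat_le u s = (u == s) || (u == 1%g).
Proof.
move=> ss; apply/idP/idP.
  case/bruhat_le_plen/orP=> [->//|]; rewrite (plen_simple ss) ltnS leqn0.
  by move/eqP/plen_eq0 ->; rewrite eqxx orbT.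
case/orP=> /eqP ->; first exact: bruhat_le_refl.
have := bruhat_ltr 1%g ss; rewrite /pmul mulg1 (plen_simple ss) (plen1 n).
by case/andP.
Qed.

Lemma plen_simple_ler s u : simple_transp s ->
  (plen (pmul u s) <= (plen u).+1)%N.
Proof.
move=> ss; rewrite -plenV /pmul invMg (simpleV ss) -/(pmul _ _) -[plen u]plenV.
exact: plen_simple_le.
Qed.

End Bruhat.

(** * Ferrers boards and lower Bruhat intervals *)

Section Boards.
Variable n : nat.
Implicit Types (i j k : 'I_n) (s u v w : 'S_n) (g : 'I_n -> nat).

Definition board g v : bool := [forall k, v k < g k]%N.

(** For [g = bound G] this is the number of edges of G, hence the length of the associated
    permutation. *)
Definition board_area g : nat := \sum_k (g k - k.+1).

Definition increasing g : Prop := forall i j, (i <= j)%N -> (g i <= g j)%N.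

Definition dyck_fun g : Prop := increasing g /\ forall k, (k < g k <= n)%N.

Lemma boardP g v : reflect (forall k, v k < g k)%N (board g v).
Proof. exact: forallP. Qed.

Lemma plen_lehmer w : plen w = (\sum_k lehmer w k)%N.
Proof.
rewrite /plen /inversions -sum1dep_card.
rewrite (eq_bigl (fun p : 'I_n * 'I_n => true && ((p.1 < p.2)%N && (w p.2 < w p.1)%N))) //.
rewrite -(pair_big_dep xpredT (fun i j : 'I_n => (i < j)%N && (w j < w i)%N) (fun _ _ => 1%N)) /=.
by apply: eq_bigr => k _; rewrite sum1dep_card.
Qed.

Lemma card_ord_ltn (m : nat) : (m <= n)%N -> #|[set k : 'I_n | (k < m)%N]| = m.
Proof.
move=> mn; rewrite -sum1dep_card -(big_ord_widen n (fun=> 1%N) mn).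
by rewrite sum1_card card_ord.
Qed.

Lemma card_perm_ltn w (m : nat) : (m <= n)%N -> #|[set k | (w k < m)%N]| = m.
Proof.
move=> mn; rewrite -{2}(card_ord_ltn mn) -(card_imset _ (@perm_inj _ w)).
congr #|pred_of_set _|; apply/setP=> y; rewrite inE; apply/imsetP/idP.
  by case=> x; rewrite inE => ? ->.
by move=> ym; exists (w^-1 y)%g; rewrite ?inE permKV.
Qed.

Section Associated.
Variables (g : 'I_n -> nat) (w : 'S_n).
Hypothesis dg : dyck_fun g.
Hypothesis codew : forall k, (lehmer w k + k.+1)%N = g k.

(** The number [w k] counts the positions carrying smaller values: [lehmer w k] of them come after
    k, and at most k before. *)
Lemma board_top : board g w.
Proof.
apply/boardP=> k; rewrite -codew addnS ltnS.
rewrite -{1}(card_perm_ltn w (ltnW (ltn_ord (w k)))) -(cardsID [set j : 'I_n | (k < j)%N]).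
apply: leq_add; first by rewrite /lehmer; apply/subset_leq_card/subsetP=> x; rewrite !inE andbC.
rewrite -[leqRHS](card_ord_ltn (ltnW (ltn_ord k))); apply/subset_leq_card/subsetP=> x.
rewrite !inE -leqNgt leq_eqVlt => /andP[/orP[/eqP/val_inj ->|->//]].
by rewrite !ltnn.
Qed.

(* Both v k and w k are values below g k not taken before k; by counting, the
   Lehmer code makes w k the largest of them. *)
Lemma board_max v k : board g v -> (forall i, (i < k)%N -> v i = w i) -> (v k <= w k)%N.
Proof.
have [incg bg] := dg => /boardP vg vw; rewrite leqNgt; apply/negP=> wvk.
pose y := (w^-1 (v k))%g; have wy : w y = v k by rewrite permKV.
have ky : (k < y)%N.
  case: (ltngtP k y) => // yk; last by move: wvk; rewrite -wy (val_inj yk) ltnn.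
  by have /perm_inj ykE := etrans (vw _ yk) wy; rewrite ykE ltnn in yk.
have /boardP wg := board_top.
(* Exactly [g k = k + lehmer w k + 1] positions carry a value of w below [g k]; the sets [A], [B]
   and {k, y} would exhibit one more. *)
have [|] := leqP (k + lehmer w k + 2) #|[set x : 'I_n | (w x < g k)%N]|.
  by rewrite card_perm_ltn -?codew; have := bg k; rewrite -?codew; lia.
rewrite ltnNge => /negP; apply.
pose A := [set j : 'I_n | (j < k)%N]; pose B := [set x : 'I_n | (k < x)%N && (w x < w k)%N].
have -> : (k + lehmer w k + 2 = #|A :|: B :|: [set k; y]|)%N.
  rewrite cardsU cards2 cardsU [#|A|]card_ord_ltn; last exact: ltnW.
  have -> : A :&: B = set0 by apply/setP=> x; rewrite !inE; lia.
  have -> : (A :|: B) :&: [set k; y] = set0.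
    apply/setP=> x; rewrite !inE; apply/negP=> /andP[+ /orP[] /eqP xE]; rewrite xE ?ltnn ?ky.
      by [].
    by rewrite ltnNge ltnW //= wy ltnNge ltnW.
  by rewrite !cards0 !subn0 -val_eqE neq_ltn ky.
apply/subset_leq_card/subsetP=> x; rewrite !inE => /orP[/orP[xk|/andP[_ xw]]|/orP[/eqP ->|/eqP ->]] //.
- by apply: leq_trans (wg x) (incg _ _ _); apply: ltnW.
- exact: ltn_trans xw _.
- by rewrite wy.
Qed.

(** Induction on the missing length, n * n being a crude bound on lengths. At the first k where v
    and w differ, v k < w k, so moving the value w k from its later position to k is an upward
    Bruhat step. It stays on the board because w lies on it and the heights increase. *)
Lemma board_le v : board g v -> bruhat_le v w.
Proof.
have [incg _] := dg; have [m] := ubnP (plen w + n * n - plen v)%N.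
elim: m v => // m IH v ltm vg.
have plen_bound u : (plen u <= n * n)%N.
  by apply: leq_trans (max_card _) _; rewrite card_prod card_ord.
have [->|vw] := eqVneq v w; first exact: bruhat_le_refl.
have [k0 vk0] : exists k, v k != w k.
  apply/existsP; move: vw; apply: contraR => /existsPn vw; apply/eqP/permP=> k; exact/eqP/negPn.
case: (@arg_minnP _ k0 (fun k => v k != w k) (@nat_of_ord n) vk0) => k vk mink.
have vwlt i : (i < k)%N -> v i = w i.
  by move=> ik; apply/eqP/negPn/negP => /mink; rewrite leqNgt ik.
have {}vk : (v k < w k)%N by rewrite ltn_neqAle vk board_max.
pose j := (v^-1 (w k))%g; have vj : v j = w k by rewrite permKV.
have kj : (k < j)%N.
  case: (ltngtP k j) => // jk; last by move: vk; rewrite -vj (val_inj jk) ltnn.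
  by have /perm_inj jkE := etrans (esym (vwlt _ jk)) vj; rewrite jkE ltnn in jk.
have lt : (v k < v j)%N by rewrite vj.
apply: (@connect_trans _ _ (pmul v (tperm k j))).
  by apply/connect1/bruhat_stepP; exists k, j.
have /boardP wg := board_top; apply: IH.
  have := plen_tperm kj lt; have := plen_bound (pmul v (tperm k j)); lia.
apply/boardP=> x; rewrite pmulE; case: tpermP => [->|->|_ _]; last exact/boardP.
  by rewrite vj.
by apply: (leq_trans _ (incg _ _ (ltnW kj))); apply/boardP.
Qed.

(** Going down a step moves the larger of two values to a later column, at least as high, and puts
    the smaller one in the earlier column. *)
Lemma board_le_closed u v : bruhat_le u v -> board g v -> board g u.
Proof.
have [incg _] := dg; case/connectP=> p; elim: p u => [|x p IH] u /=; first by move=> _ ->.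
case/andP=> /bruhat_stepP[i [j [ij uij xE]]] px vE /(IH _ px vE) /boardP; rewrite xE => xg.
have := xg i; have := xg j; rewrite !pmulE tpermL tpermR => gj gi.
apply/boardP=> k; case: (eqVneq i k) => [<-|ik]; first exact: ltn_trans gi.
case: (eqVneq j k) => [<-|jk]; last by have := xg k; rewrite pmulE tpermD.
by apply: leq_trans gi (incg _ _ (ltnW ij)).
Qed.

Lemma bruhat_boardE v : bruhat_le v w = board g v.
Proof. by apply/idP/idP => [/board_le_closed|/board_le//]; apply; apply: board_top. Qed.

End Associated.
End Boards.

(** * Exchange property of boards with a lowered column *)

Section Exchange.
Variable n : nat.
Implicit Types (i j k : 'I_n) (s u v w : 'S_n) (g : 'I_n -> nat).

(* The combinatorial content of c_s 1_B' = 1_B + q 1_B'', with sigma the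
   multiplication by s. *)
Definition exchange (sigma : 'S_n -> 'S_n) (B B' B'' : pred 'S_n) : Prop :=
  forall u, (plen u < plen (sigma u))%N ->
    [/\ B u = B' u, B (sigma u) = B' u, B'' u = B' (sigma u) & B'' (sigma u) = B' (sigma u)].

Definition lower g i m : 'I_n -> nat := fun k => (g k - (k == i) * m)%N.

(** When u is shorter than s u, the value j1 stands at a position p before the position r of j.
    Columns left of i admit neither value and columns right of i admit both, so only p = i tells the
    boards apart: column i admits both values in [g], only j1 in [lower g i 1], and neither in
    [lower g i 2]. *)
Lemma exchange_board g i j1 j : increasing g -> j = j1.+1 :> nat -> g i = j.+1 ->
  (forall k, (k < i)%N -> (g k <= j1)%N) ->
  exchange (pmul (tperm j1 j)) (board g) (board (lower g i 1)) (board (lower g i 2)).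
Proof.
move=> incg jj1 gi gx u; have ss : simple_transp (tperm j1 j) by apply/simpleP; exists j1, j.
set s := tperm j1 j => ltu.
pose p := (u^-1 j1)%g; pose r := (u^-1 j)%g.
have up : u p = j1 by rewrite permKV.
have ur : u r = j by rewrite permKV.
have pr : (p < r)%N.
  have := plen_adjl u jj1; rewrite ltnNge (ltnW ltu) -/p -/r => /esym/negbT.
  rewrite -leqNgt leq_eqVlt => /orP[/eqP/val_inj prE|//].
  by move: jj1; rewrite -up -ur prE => /n_Sn.
have sp : pmul s u p = j by rewrite pmulE up tpermL.
have sr : pmul s u r = j1 by rewrite pmulE ur tpermR.
have sk k : k = p \/ k = r \/
    [/\ pmul s u k = u k :> nat, u k <> j1 :> nat & u k <> j :> nat].
  have [->|kp] := eqVneq k p; first by left.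
  have [->|kr] := eqVneq k r; first by right; left.
  right; right; rewrite pmulE tpermD; first split => // /val_inj.
  - by rewrite -up => /perm_inj/eqP; rewrite (negbTE kp).
  - by rewrite -ur => /perm_inj/eqP; rewrite (negbTE kr).
  - by rewrite -up; apply: contra kp => /eqP/perm_inj ->.
  - by rewrite -ur; apply: contra kr => /eqP/perm_inj ->.
have lowE k : [\/ [/\ (k < i)%N, (g k <= j1)%N, lower g i 1 k = g k & lower g i 2 k = g k],
    [/\ k = i :> nat, g k = j1.+2, lower g i 1 k = j1.+1 & lower g i 2 k = j1]
  | [/\ (i < k)%N, (j1.+1 < g k)%N, lower g i 1 k = g k & lower g i 2 k = g k]].
  have := gx k; have := incg i k; rewrite /lower -val_eqE /= gi jj1.
  case: (ltngtP k i) => [ki _ /(_ isT) gk|ik /(_ isT) gk _|/val_inj -> _ _].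
  - by constructor 1; rewrite !mul0n !subn0.
  - by constructor 3; rewrite !mul0n !subn0.
  - by constructor 2; rewrite gi jj1 !mul1n subn1 subn2.
(* Each column k is settled from the conditions at p, r and k alone, which leaves linear
   arithmetic. *)
have goal (v1 v2 : 'S_n) g1 g2 :
    (forall k, v1 p < g1 p -> v1 r < g1 r -> v1 k < g1 k -> v2 k < g2 k)%N ->
    board g1 v1 -> board g2 v2.
  by move=> H /boardP b1; apply/boardP=> k; apply: H.
have lp := lowE p; have lr := lowE r.
split; apply/idP/idP; apply: goal => k; rewrite ?up ?ur ?sp ?sr ?jj1;
  have lk := lowE k; have [->|[->|[]]] := sk k; rewrite ?up ?ur ?sp ?sr ?jj1;
  try move: (pmul s u k : nat) (u k : nat) => suk uk;
  move: (lower g i 1) (lower g i 2) lp lr lk pr => l1 l2; clear.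
all: by case=> -[? ? ? ?] [] [? ? ? ?] [] [? ? ? ?] *; lia.
Qed.
End Exchange.

(** * Boards of Dyck graphs and Lee triples *)

Section DyckBoards.
Variable n : nat.
Implicit Types (G H : rel 'I_n) (i j k x y : 'I_n) (s u v w : 'S_n).

(** In 0-based numbering, the exclusive end of the interval of right neighbours of k when G is a
    Dyck graph. *)
Definition bound G k : nat := (code G k + k.+1)%N.

(** The edge form of the board, on which the mirror symmetry is visible. *)
Definition graph_board G v : bool := [forall k : 'I_n, (k < v k)%N ==> G k (v k)].

Definition nedges G : nat := #|[set p : 'I_n * 'I_n | (p.1 < p.2)%N && G p.1 p.2]|.

Lemma nedges_code G : nedges G = (\sum_k code G k)%N.
Proof.
rewrite /nedges -sum1dep_card.
rewrite (eq_bigl (fun p : 'I_n * 'I_n => true && ((p.1 < p.2)%N && G p.1 p.2))) //.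
rewrite -(pair_big_dep xpredT (fun i j : 'I_n => (i < j)%N && G i j) (fun _ _ => 1%N)) /=.
by apply: eq_bigr => k _; rewrite sum1dep_card.
Qed.

Lemma plen_associated G w : associated G w -> plen w = nedges G.
Proof. by move=> Gw; rewrite plen_lehmer nedges_code; apply: eq_bigr => k _; apply: Gw. Qed.

Lemma eq_code G H : G =2 H -> code G =1 code H.
Proof. by move=> GH k; rewrite /code; congr #|pred_of_set _|; apply/setP=> x; rewrite !inE GH. Qed.

Lemma eq_graph_board G H : G =2 H -> graph_board G =1 graph_board H.
Proof. by move=> GH v; apply: eq_forallb => k; rewrite GH. Qed.

Lemma eq_nedges G H : G =2 H -> nedges G = nedges H.
Proof. by move=> GH; rewrite !nedges_code; apply: eq_bigr => k _; apply: eq_code. Qed.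

Lemma eq_dyck G H : G =2 H -> dyck G -> dyck H.
Proof.
move=> GH [Gs Gi Gd]; split=> [x y|x|i j x y]; rewrite -!GH //.
exact: Gd.
Qed.

Lemma card_ord_itv (a b : nat) : (b <= n)%N -> #|[set k : 'I_n | (a <= k < b)%N]| = (b - a)%N.
Proof.
move=> bn; have [ab|ba] := leqP a b; last first.
  by rewrite eq_card0 => [|x]; rewrite ?inE; lia.
rewrite -[b in RHS](card_ord_ltn bn) -[a in RHS](card_ord_ltn (leq_trans ab bn)).
rewrite -cardsDS; last by apply/subsetP=> x; rewrite !inE => /leq_trans; apply.
by apply: eq_card => x; rewrite !inE -leqNgt.
Qed.

(** The Dyck condition makes the right neighbours of i an interval starting at i + 1, hence
    determined by its cardinality. *)
Lemma dyck_edgeE G i k : dyck G -> (i < k)%N -> G i k = (k < bound G i)%N.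
Proof.
case=> _ _ Gd ik; rewrite /bound /code; apply/idP/idP => [Gik|].
  have : (k.+1 - i.+1 <= #|[set k0 : 'I_n | (i < k0)%N && G i k0]|)%N.
    rewrite -card_ord_itv //; apply/subset_leq_card/subsetP=> x; rewrite !inE ltnS.
    by case/andP=> ix xk; rewrite ix (Gd i k).
  lia.
apply: contraLR => nG; rewrite -leqNgt.
have : (#|[set k0 : 'I_n | (i < k0)%N && G i k0]| <= k - i.+1)%N.
  rewrite -card_ord_itv; last exact: ltnW.
  apply/subset_leq_card/subsetP=> x; rewrite !inE => /andP[ix Gix]; rewrite ix ltnNge.
  by apply: contra nG => kx; apply: (Gd i x).
lia.
Qed.

Lemma bound_gt G k : (k < bound G k)%N.
Proof. by rewrite /bound; lia. Qed.

Lemma bound_le G k : (bound G k <= n)%N.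
Proof.
rewrite /bound /code; have : (#|[set x : 'I_n | (k < x)%N && G k x]| <= n - k.+1)%N.
  rewrite -card_ord_itv //; apply/subset_leq_card/subsetP=> x.
  by rewrite !inE ltn_ord andbT => /andP[].
have := ltn_ord k; lia.
Qed.

Lemma bound_dyck_fun G : dyck G -> dyck_fun (bound G).
Proof.
move=> dG; split=> [i j ij|k]; last by rewrite bound_gt bound_le.
have [->//|ij'] := eqVneq i j; have {ij' ij} ij : (i < j)%N by rewrite ltn_neqAle ij'.
have [le|lt] := leqP (bound G i) j.+1; first exact: leq_trans (bound_gt _ _).
have x_n : ((bound G i).-1 < n)%N by have := bound_le G i; lia.
(* The last right neighbour x of i lies to the right of j, so it is adjacent to j as well. *)
pose x := Ordinal x_n; have xE : (bound G i = x.+1) by rewrite /=; lia.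
have jx : (j < x)%N by rewrite /=; lia.
have ix : (i < x)%N by apply: ltn_trans jx.
rewrite xE -dyck_edgeE //; case: (dG) => _ _ Gd; apply: (Gd i x) => //; last exact: ltnW.
by rewrite dyck_edgeE // xE.
Qed.

Lemma graph_boardE G v : dyck G -> graph_board G v = board (bound G) v.
Proof.
move=> dG; apply: eq_forallb => k; case: ltnP => kv; first by rewrite dyck_edgeE.
by rewrite (leq_ltn_trans kv) ?bound_gt.
Qed.

Lemma bruhat_graph_board G w v : dyck G -> associated G w ->
  bruhat_le v w = graph_board G v.
Proof.
move=> dG Gw; rewrite graph_boardE //.
by apply: (bruhat_boardE (bound_dyck_fun dG)) => k; rewrite Gw.
Qed.

Lemma in_set2_eq (a b x y : 'I_n) : ([set a; b] == [set x; y]) =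
  ((a == x) && (b == y)) || ((a == y) && (b == x)).
Proof.
apply/eqP/orP => [/setP e|[]/andP[/eqP -> /eqP ->]]; [|by []|by rewrite setUC].
have := e a; have := e b; have := e x; have := e y; rewrite !inE !eqxx !orbT /=.
rewrite ![x == _]eq_sym ![y == _]eq_sym.
case: (eqVneq a x) => [->|_]; case: (eqVneq b y) => [->|_]; rewrite ?eqxx ?andbT ?orbT //=; auto.
all: by case: eqP => //=; case: eqP => //=; auto.
Qed.

Lemma del_edgeE G i j x y : (i < j)%N -> (x < y)%N ->
  del_edge G i j x y = G x y && ((x, y) != (i, j)).
Proof.
move=> ij xy; rewrite /del_edge in_set2_eq xpair_eqE; congr (_ && ~~ _).
by rewrite -!val_eqE /=; lia.
Qed.

Lemma del_edge_sym G i j : symmetric G -> symmetric (del_edge G i j).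
Proof. by move=> Gs x y; rewrite /del_edge Gs setUC. Qed.

Lemma del_edge_irr G i j : irreflexive G -> irreflexive (del_edge G i j).
Proof. by move=> Gs x; rewrite /del_edge Gs. Qed.

(** An edge nested in no other edge is forced by no instance of the Dyck condition. *)
Lemma del_edge_dyck G i j : dyck G -> (i < j)%N ->
  (forall x y : 'I_n, (x <= i)%N -> (j <= y)%N -> (x < y)%N -> G x y -> x = i /\ y = j) ->
  dyck (del_edge G i j).
Proof.
case=> Gs Gi Gd ij corner; split; [exact: del_edge_sym|exact: del_edge_irr|].
move=> x y x' y' xy + xx' xy' yy'; rewrite !del_edgeE // => /andP[Gxy nxy].
rewrite (Gd x y) //=; apply: contra nxy; rewrite !xpair_eqE => /andP[/eqP x'i /eqP y'j].
by have [] := corner x y; rewrite -?x'i -?y'j ?Gxy //= => -> ->; rewrite x'i y'j !eqxx.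
Qed.

Lemma code_del_edge G i j k : (i < j)%N -> G i j ->
  code (del_edge G i j) k = (code G k - (k == i))%N.
Proof.
move=> ij Gij; rewrite /code; have [->|ki] := eqVneq k i.
  rewrite [X in (X - _)%N](cardsD1 j) !inE ij Gij add1n subn1 /=.
  apply: eq_card => x; rewrite !inE; have [ix|] := ltnP i x; last by rewrite andbF.
  by rewrite del_edgeE // xpair_eqE eqxx /= andbC.
rewrite subn0; apply: eq_card => x; rewrite !inE; have [kx|//] := ltnP k x.
by rewrite del_edgeE // xpair_eqE (negbTE ki) andbT.
Qed.

Lemma bound_del_edge G i j k : (i < j)%N -> G i j ->
  bound (del_edge G i j) k = lower (bound G) i 1 k.
Proof.
move=> ij Gij; rewrite /bound /lower code_del_edge // muln1.
have [->|_] := eqVneq k i; last by rewrite !subn0.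
have : (0 < code G i)%N; last by lia.
by rewrite card_gt0; apply/set0Pn; exists j; rewrite inE ij.
Qed.

Lemma nedges_del_edge G i j : (i < j)%N -> G i j ->
  nedges G = (nedges (del_edge G i j)).+1.
Proof.
move=> ij Gij; rewrite /nedges (cardsD1 (i, j)) inE /= ij Gij add1n; congr _.+1.
apply: eq_card => -[x y]; rewrite !inE /=; have [xy|] := ltnP x y; last by rewrite andbF.
by rewrite del_edgeE // andbC.
Qed.

End DyckBoards.

(** * Mirror images of graphs and permutations *)

Section Mirror.
Variable n : nat.
Implicit Types (G H : rel 'I_n) (i j k x y : 'I_n) (s u v w : 'S_n).

Definition rev_perm : 'S_n := perm (@rev_ord_inj n).

(** The map v -> w_0 v^-1 w_0. It preserves length and reverses products, so it exchanges left and
    right multiplication. *)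
Definition rev_inv v : 'S_n := pmul rev_perm (pmul v^-1%g rev_perm).

Lemma rev_permE x : rev_perm x = rev_ord x.
Proof. exact: permE. Qed.

Lemma rev_perm2 : (rev_perm * rev_perm = 1)%g.
Proof. by apply/permP=> x; rewrite permM perm1 !rev_permE rev_ordK. Qed.

Lemma rev_permV : (rev_perm^-1 = rev_perm)%g.
Proof. by apply: (mulgI rev_perm); rewrite mulgV rev_perm2. Qed.

Lemma rev_invK : involutive rev_inv.
Proof.
move=> v; rewrite /rev_inv /pmul !invMg invgK rev_permV.
by rewrite -!mulgA rev_perm2 mulg1 mulgA rev_perm2 mul1g.
Qed.

Lemma rev_inv_pmul u v : rev_inv (pmul u v) = pmul (rev_inv v) (rev_inv u).
Proof.
rewrite /rev_inv /pmul invMg -!mulgA; congr (_ * (_ * _))%g.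
by rewrite [RHS]mulgA rev_perm2 mul1g.
Qed.

Lemma rev_inv_tperm i j : rev_inv (tperm i j) = tperm (rev_ord i) (rev_ord j).
Proof.
by rewrite /rev_inv /pmul tpermV -{1}rev_permV -mulgA -conjgE tpermJ !rev_permE.
Qed.

Lemma rev_invE v k : rev_inv v (rev_ord (v k)) = rev_ord k.
Proof. by rewrite !pmulE !rev_permE rev_ordK permK. Qed.

Lemma ltn_rev_ord x y : (rev_ord x < rev_ord y)%N = (y < x)%N.
Proof. by rewrite /=; have := ltn_ord x; have := ltn_ord y; lia. Qed.

Lemma plen_rev_inv v : plen (rev_inv v) = plen v.
Proof.
have le u : (plen u <= plen (rev_inv u))%N.
  pose f (p : 'I_n * 'I_n) := (rev_ord (u p.1), rev_ord (u p.2)).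
  have finj : injective f.
    move=> [a b] [c d] /eqP; rewrite xpair_eqE /=.
    by case/andP=> /eqP/rev_ord_inj/perm_inj -> /eqP/rev_ord_inj/perm_inj ->.
  rewrite /plen -(card_imset _ finj); apply/subset_leq_card/subsetP=> p /imsetP[[a b]].
  by rewrite !inE /f /= => /andP[ab ba] ->; rewrite !rev_invE !ltn_rev_ord ab ba.
by apply/eqP; rewrite eqn_leq le -{2}[v]rev_invK le.
Qed.

Lemma simple_rev_inv s : simple_transp s -> simple_transp (rev_inv s).
Proof.
case/simpleP=> i [j [ij ->]]; rewrite rev_inv_tperm tpermC; apply/simpleP.
exists (rev_ord j), (rev_ord i); split=> //=; have := ltn_ord j; lia.
Qed.

(** A pair (k, v k) of v corresponds to the pair (rev (v k), rev k) of [rev_inv v]; the order of the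
    two entries is kept and {k, v k} goes to its mirror image. *)
Lemma graph_board_mirror G v : symmetric G ->
  graph_board (mirror G) v = graph_board G (rev_inv v).
Proof.
move=> Gs; apply/forallP/forallP => vG k.
  have := vG (v^-1 (rev_ord k))%g; rewrite permKV /mirror rev_ordK Gs.
  have := rev_invE v (v^-1 (rev_ord k))%g; rewrite permKV rev_ordK => ->.
  by rewrite -(ltn_rev_ord (rev_ord k)) rev_ordK.
have := vG (rev_ord (v k)); rewrite rev_invE ltn_rev_ord.
by rewrite Gs.
Qed.

Lemma mirror_dyck G : dyck G -> dyck (mirror G).
Proof.
case=> Gs Gi Gd; split=> [x y|x|i j x y ij Gij ix xy yj]; rewrite /mirror //.
rewrite Gs; apply: (Gd (rev_ord j) (rev_ord i)); rewrite ?ltn_rev_ord // 1?Gs //.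
  by rewrite leqNgt ltn_rev_ord -leqNgt.
by rewrite leqNgt ltn_rev_ord -leqNgt.
Qed.

Lemma nedges_mirror G : symmetric G -> nedges (mirror G) = nedges G.
Proof.
move=> Gs; have le H : symmetric H -> (nedges H <= nedges (mirror H))%N.
  move=> Hs; pose f (p : 'I_n * 'I_n) := (rev_ord p.2, rev_ord p.1).
  have finj : injective f.
    move=> [a b] [c d] /eqP; rewrite xpair_eqE /=.
    by case/andP=> /eqP/rev_ord_inj -> /eqP/rev_ord_inj ->.
  rewrite /nedges -(card_imset _ finj); apply/subset_leq_card/subsetP=> p /imsetP[[a b]].
  by rewrite !inE /f /= => /andP[ab ba] ->; rewrite /mirror !rev_ordK ltn_rev_ord ab Hs.
apply/eqP; rewrite eqn_leq le // andbT.
rewrite (_ : nedges G = nedges (mirror (mirror G))) ?le //; first by move=> x y; apply: Gs.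
by apply: eq_nedges => x y; rewrite /mirror !rev_ordK.
Qed.

End Mirror.

Lemma eq_exchange n (sigma : 'S_n -> 'S_n) B1 B2 B1' B2' B1'' B2'' :
  B1 =1 B2 -> B1' =1 B2' -> B1'' =1 B2'' ->
  exchange sigma B1 B1' B1'' -> exchange sigma B2 B2' B2''.
Proof. by move=> e e' e'' ex u /ex; rewrite !e !e' !e''. Qed.

Lemma eq_board n (g1 g2 : 'I_n -> nat) : g1 =1 g2 -> board g1 =1 board g2.
Proof. by move=> e v; apply: eq_forallb => k; rewrite e. Qed.

Section LeeTriples.
Variable n : nat.
Implicit Types (G H : rel 'I_n) (i j k x y : 'I_n) (s u v w : 'S_n).

Lemma graph_board_pmulr G s v : dyck G -> simple_transp s ->
  (forall k, bound G (s k) = bound G k) -> graph_board G (pmul v s) = graph_board G v.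
Proof.
move=> dG ss sG; rewrite !graph_boardE //.
have le u : board (bound G) u -> board (bound G) (pmul u s).
  by move=> /boardP b; apply/boardP=> k; rewrite pmulE -sG.
by apply/idP/idP => [/le|/le //]; rewrite pmulsK.
Qed.

(** Column heights are the form of admissibility on which both the Hecke and the chromatic arguments
    rest. *)
Lemma lee_first_bounds G G' G'' : lee_first G G' G'' -> exists i j1 j,
  [/\ [/\ j = j1.+1 :> nat, (i < j1)%N, G i j & del_edge G i j i j1],
      [/\ bound G i = j.+1, forall k, (k < i)%N -> (bound G k <= j1)%N
        & bound G j1 = bound G j],
      [/\ dyck G, dyck (del_edge G i j) & dyck (del_edge (del_edge G i j) i j1)],
      G' =2 del_edge G i j & G'' =2 del_edge (del_edge G i j) i j1].
Proof.
case=> dG [i [j [j1 [[/andP[ij Gij] jE codei code2 codej] jj1 G'E G''E]]]].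
have ij1 : (i < j1)%N by lia.
have [incb _] := bound_dyck_fun dG.
have bi : bound G i = j.+1 by rewrite /bound; lia.
have bx k : (k < i)%N -> (bound G k <= j1)%N.
  (* Heights increase, so bounding the column i - 1 is enough. *)
  move=> ki; have i1_n : (i.-1 < n)%N by have := ltn_ord i; lia.
  pose i1 := Ordinal i1_n; have iE : i = i1.+1 :> nat by rewrite /=; lia.
  have : (bound G k <= bound G i1)%N by apply: incb; rewrite /=; lia.
  by have := codei _ iE; rewrite /bound; lia.
have dG' : dyck (del_edge G i j).
  apply: del_edge_dyck => // x y xi jy xy; rewrite dyck_edgeE // => yx.
  have {}xi : x = i.
    by apply/val_inj; case: (ltngtP x i) xi => // /bx; lia.
  by split=> //; apply/val_inj => /=; move: yx; rewrite xi bi; lia.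
have G'ij1 : del_edge G i j i j1.
  by rewrite del_edgeE // dyck_edgeE // bi xpair_eqE -!val_eqE /=; lia.
exists i, j1, j; split=> //; first by split=> //; rewrite /bound; have := codej j1 jj1; lia.
split=> //; apply: del_edge_dyck => // x y xi jy xy.
rewrite dyck_edgeE // bound_del_edge // => yx.
have {}xi : x = i.
  by apply/val_inj; case: (ltngtP x i) xi => // /bx; move: yx; rewrite /lower; lia.
by split=> //; apply/val_inj => /=; move: yx; rewrite /lower xi bi eqxx; lia.
Qed.

(** The witness is (j1 j). On the left it exchanges the values j1 and j, as in [exchange_board]; on
    the right it permutes two columns of equal height. *)
Lemma exchange_first G G' G'' : lee_first G G' G'' ->
  exists s, [/\ simple_transp s,
    [/\ dyck G, dyck G' & dyck G''],
    exchange (pmul s) (graph_board G) (graph_board G') (graph_board G''),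
    forall v, graph_board G' (pmul v s) = graph_board G' v
    & nedges G = (nedges G').+1 /\ nedges G' = (nedges G'').+1].
Proof.
case/lee_first_bounds=> i [j1 [j [[jj1 ij1 Gij G'ij1] [bi bx bj] [dG dG' dG''] G'E G''E]]].
have ij : (i < j)%N by rewrite jj1 ltnS ltnW.
have ss : simple_transp (tperm j1 j) by apply/simpleP; exists j1, j.
have [incb _] := bound_dyck_fun dG.
exists (tperm j1 j); split=> //.
- by split=> //; [apply: eq_dyck dG' | apply: eq_dyck dG''] => x y; rewrite ?G'E ?G''E.
- apply: eq_exchange (exchange_board incb jj1 bi bx) => v.
  + by rewrite graph_boardE.
  + rewrite (eq_graph_board G'E) graph_boardE //; apply: eq_board => k.
    by rewrite bound_del_edge.
  + rewrite (eq_graph_board G''E) graph_boardE //; apply: eq_board => k.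
    by rewrite !bound_del_edge // /lower bound_del_edge // /lower; lia.
- move=> v; rewrite !(eq_graph_board G'E); apply: graph_board_pmulr => // k.
  rewrite !bound_del_edge // /lower; case: tpermP => [->|->|//];
  by rewrite bj -!val_eqE /=; lia.
- by rewrite (eq_nedges G'E) (eq_nedges G''E) -!nedges_del_edge.
Qed.

(** Transport of the first type by [rev_inv], which turns left multiplication by s into right
    multiplication by [rev_inv s]. *)
Lemma exchange_second G G' G'' : lee_second G G' G'' ->
  exists s, [/\ simple_transp s,
    [/\ dyck G, dyck G' & dyck G''],
    exchange ((@pmul n)^~ s) (graph_board G) (graph_board G') (graph_board G''),
    forall v, graph_board G' (pmul s v) = graph_board G' v
    & nedges G = (nedges G').+1 /\ nedges G' = (nedges G'').+1].
Proof.
case=> [H [H' [H'' [/exchange_first[s [ss [dH dH' dH''] ex cl [e1 e2]]]]]]] [GE G'E G''E].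
have [[sH _ _] [sH' _ _] [sH'' _ _]] := And3 dH dH' dH''.
exists (rev_inv s); split.
- exact: simple_rev_inv.
- by split; [apply: eq_dyck (mirror_dyck dH) | apply: eq_dyck (mirror_dyck dH')
    | apply: eq_dyck (mirror_dyck dH'')] => x y; rewrite ?GE ?G'E ?G''E.
- move=> u ltu; rewrite !(eq_graph_board GE) !(eq_graph_board G'E) !(eq_graph_board G''E).
  rewrite !graph_board_mirror // rev_inv_pmul rev_invK; apply: ex.
  by rewrite plen_rev_inv -[s]rev_invK -rev_inv_pmul plen_rev_inv.
- by move=> v; rewrite !(eq_graph_board G'E) !graph_board_mirror // rev_inv_pmul rev_invK.
- by rewrite (eq_nedges GE) (eq_nedges G'E) (eq_nedges G''E) !nedges_mirror.
Qed.

(** The graphs determine the two removed edges, which share their left end in the first type and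
    their right end in the second. Hence a single s serves both implications of the theorem, one of
    them being vacuous. *)
Lemma lee_exclusive G G' G'' : lee_first G G' G'' -> lee_second G G' G'' -> False.
Proof.
case=> [dG [i [j [j1 [[/andP[ij Gij] jE codei code2 codej] jj1 G'E G''E]]]]].
case=> [H [H' [H'' [[dH [i2 [j2 [j3 [[/andP[ij2 _] _ _ _ _] jj3 H'E H''E]]]]] [GE G'M G''M]]]]].
have G'ij : ~~ G' i j by rewrite G'E /del_edge eqxx andbF.
have G'ij1 : G' i j1.
  by rewrite G'E del_edgeE ?dyck_edgeE /bound ?xpair_eqE -?val_eqE //=; lia.
have G''ij1 : ~~ G'' i j1 by rewrite G''E /del_edge eqxx andbF.
move: G'ij; rewrite G'M /mirror H'E /del_edge -[H _ _]/(mirror H i j) -GE Gij /= negbK.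
move: G''ij1; rewrite G''M /mirror H''E /del_edge -/(del_edge H i2 j2 _ _) -H'E.
rewrite -[H' _ _]/(mirror H' i j1) -G'M G'ij1 /= negbK.
rewrite !in_set2_eq -!val_eqE /=.
have := ltn_ord i; have := ltn_ord j; have := ltn_ord j2; have := ltn_ord i2; lia.
Qed.

End LeeTriples.

(** * Sums of standard basis elements in the Hecke algebra *)

Section HeckeIndicators.
Variables (K : fieldType) (q : K) (n : nat).
Local Notation H := (hecke q n).
Implicit Types (s u v w : 'S_n) (x y : H) (B : pred 'S_n).

Lemma heckeT_mull s x : simple_transp s -> heckeT q s * x = heckeL s x.
Proof.
move=> ss; rewrite -[x in RHS]mul1r -[RHS]/(heckeL s (hecke_mul 1 x)) hecke_mulL //.
congr (_ * _); rewrite -heckeT1 heckeLT // plen1.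
by rewrite /pmul mul1g plen_simple.
Qed.

Lemma heckeT_mulr s x : simple_transp s -> x * heckeT q s = heckeR s x.
Proof.
move=> ss; rewrite -[x in RHS]mulr1 -[RHS]/(heckeR s (hecke_mul x 1)) -hecke_mulR //.
congr (_ * _); rewrite -heckeT1 heckeRT // /pmul mulg1 ?plen1 //.
by rewrite plen_simple.
Qed.

(* [heckeL s] and [heckeR s] are the cases [pmul s] and [pmul^~ s], by conversion. *)
Definition hecke_act (sigma : 'S_n -> 'S_n) x : H := [ffun w =>
  if (plen (sigma w) < plen w)%N then x (sigma w) + (q - 1) * x w
  else q * x (sigma w)].

Definition indicator B : H := [ffun u => (B u)%:R].

Lemma indicatorE B : indicator B = \sum_(v | B v) heckeT q v.
Proof.
rewrite [LHS]heckeT_sum [RHS]big_mkcond; apply: eq_bigr => v _; rewrite ffunE.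
by case: (B v); rewrite ?scale1r ?scale0r.
Qed.

Lemma eq_indicator B1 B2 : B1 =1 B2 -> indicator B1 = indicator B2.
Proof. by move=> e; apply/ffunP=> u; rewrite !ffunE e. Qed.

Section Action.
Variable sigma : 'S_n -> 'S_n.
Hypothesis sigmaK : involutive sigma.
Hypothesis plen_sigma : forall u, plen (sigma u) != plen u.

(** On a pair {u, sigma u} with u the shorter, both coordinates of the left-hand side equal B'(u) +
    q B'(sigma u), which [exchange] reads as B + q B''. *)
Lemma indicator_exchange B B' B'' : exchange sigma B B' B'' ->
  indicator B' + hecke_act sigma (indicator B') = indicator B + q *: indicator B''.
Proof.
move=> ex; apply/ffunP=> u; rewrite !ffunE /GRing.scale /=.
case: (ltngtP (plen (sigma u)) (plen u)) (plen_sigma u) => // lt _.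
  have [] := ex (sigma u); rewrite sigmaK // => _ -> _ ->; ring.
by have [-> _ -> _] := ex _ lt.
Qed.

Lemma indicator_closed B : (forall u, B (sigma u) = B u) ->
  indicator B + hecke_act sigma (indicator B) = (q + 1) *: indicator B.
Proof.
move=> cl; apply/ffunP=> u; rewrite !ffunE /GRing.scale /= cl.
by case: ifP => _; ring.
Qed.

Lemma sum_pairs (V : nmodType) (F : 'S_n -> V) :
  \sum_u F u = \sum_(u | (plen u < plen (sigma u))%N) (F u + F (sigma u)).
Proof.
rewrite (bigID (fun u => plen u < plen (sigma u))%N) big_split /=; congr (_ + _).
rewrite (reindex_inj (inv_inj sigmaK)); apply: eq_bigl => u; rewrite sigmaK -leqNgt.
by rewrite leq_eqVlt eq_sym (negbTE (plen_sigma u)).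
Qed.

End Action.

Hypothesis q0 : q != 0.

Lemma heckeT_simpleV s : simple_transp s ->
  heckeT q s \is a GRing.unit /\ (heckeT q s)^-1 = q^-1 *: (heckeT q s - (q - 1)%:A).
Proof.
move=> ss; set y := q^-1 *: _.
have TT : heckeT q s * heckeT q s = (q - 1) *: heckeT q s + q%:A.
  by rewrite heckeT_mul // /pmul simpleK // plen1 ltn0 heckeT1.
have yT : y * heckeT q s = 1.
  by rewrite -scalerAl mulrBl TT mulr_algl addrC addKr scalerA mulVf // scale1r.
have Ty : heckeT q s * y = 1.
  by rewrite -scalerAr mulrBr TT mulr_algr addrC addKr scalerA mulVf // scale1r.
have u : heckeT q s \is a GRing.unit by apply/unitrP; exists y.
by split=> //; rewrite -[y]mulr1 -(mulrV u) mulrA yT mul1r.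
Qed.

Lemma heckeT_simpleV_add1 s : simple_transp s ->
  1 + (heckeT q s)^-1 = q^-1 *: (1 + heckeT q s).
Proof.
move=> ss; have [_ ->] := heckeT_simpleV ss.
rewrite -heckeT1; move: (heckeT q s) (heckeT q 1%g) => x y.
by apply/ffunP=> v; rewrite !ffunE /GRing.scale /=; field.
Qed.

(* The image of [heckeT q v] under the bar involution. *)
Definition barT v : H := (heckeT q v^-1%g)^-1.

(** The image of [indicator B] under the bar involution, expanded term by term instead of building
    the involution as a map. *)
Definition bar_sum B : H := \sum_(v | B v) barT v.

Lemma heckeT_unit v : heckeT q v \is a GRing.unit.
Proof.
apply: (@heckeT_ind K q n (fun x => x \is a GRing.unit)); first by rewrite heckeT1 unitr1.
by move=> t x st xu; rewrite -heckeT_mulr // unitrMl //; have [] := heckeT_simpleV st.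
Qed.

Lemma barT_up s v : simple_transp s -> (plen v < plen (pmul s v))%N ->
  barT (pmul s v) = (heckeT q s)^-1 * barT v.
Proof.
move=> ss lt; rewrite /barT; have [sU _] := heckeT_simpleV ss.
have svE : (pmul s v)^-1%g = pmul v^-1%g s by rewrite /pmul invMg (simpleV ss).
rewrite svE -invrM ?heckeT_unit // heckeT_mulr // heckeRT //.
by rewrite -svE !plenV.
Qed.

(** The bar image of T_s T_{sv} = q T_v + (q - 1) T_{sv}. *)
Lemma barT_down s v : simple_transp s -> (plen v < plen (pmul s v))%N ->
  (heckeT q s)^-1 * barT (pmul s v) = q^-1 *: barT v + (q^-1 - 1) *: barT (pmul s v).
Proof.
move=> ss lt; rewrite barT_up //; have [sU TV] := heckeT_simpleV ss.
rewrite {1}TV -scalerAl mulrBl mulVKr // mulr_algl scalerBr; congr (_ + _).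
move: (_^-1 * _) => x; apply/ffunP=> w; by rewrite !ffunE /GRing.scale /=; field.
Qed.

(** The bar image of [indicator_exchange], in which 1 + T_s becomes 1 + T_s^-1 = q^-1 (1 + T_s). It
    is again checked on the pairs {u, s u}. *)
Lemma bar_sum_exchange s B B' B'' : simple_transp s -> exchange (pmul s) B B' B'' ->
  q^-1 *: (bar_sum B' + heckeL s (bar_sum B')) = bar_sum B + q^-1 *: bar_sum B''.
Proof.
move=> ss ex; have [sU TV] := heckeT_simpleV ss.
have -> x : q^-1 *: (x + heckeL s x) = x + (heckeT q s)^-1 * x.
  rewrite TV -scalerAl mulrBl heckeT_mull // mulr_algl.
  move: (heckeL s x) => y; apply/ffunP=> w; by rewrite !ffunE /GRing.scale /=; field.
pose F B u : H := (B u)%:R *: barT u.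
have SF (C : pred 'S_n) : bar_sum C = \sum_u F C u.
  by rewrite /bar_sum big_mkcond; apply: eq_bigr => u _; rewrite /F; case: (C u); rewrite ?scale1r ?scale0r.
have sK : involutive (pmul s) by move=> u; rewrite pmulKs.
have sN u := plen_simple_neql u ss.
rewrite !SF !(sum_pairs sK sN) mulr_sumr scaler_sumr -!big_split /=.
apply: eq_bigr => u lt; rewrite /F; have [-> -> -> ->] := ex u lt.
have D := barT_down ss lt; have U := esym (barT_up ss lt).
have -> (c d : K) (t x y : H) : t * (c *: x + d *: y) = c *: (t * x) + d *: (t * y).
  by rewrite mulrDr !scalerAr.
rewrite D U; move: (barT u) (barT (pmul s u)) => x y.
apply/ffunP=> w; rewrite !ffunE /GRing.scale /=; ring.
Qed.

(** Triangularity of the bar involution: [barT v] is q^(-l(v)) T_v plus terms of smaller length, by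
    induction on l(v), peeling off a left descent. *)
Lemma barT_coord v w : (plen v <= plen w)%N -> barT v w = q ^- plen v * (w == v)%:R.
Proof.
have [m] := ubnP (plen v); elim: m v w => // m IH v w ltm vw.
have [->|/simple_descent[s ss sv]] := eqVneq v 1%g.
  by rewrite /barT invg1 heckeT1 invr1 -heckeT1 ffunE plen1 expr0 invr1 mul1r.
have lu : (plen (pmul s v) < plen (pmul s (pmul s v)))%N by rewrite pmulKs.
have := barT_up ss lu; rewrite pmulKs //; have [_ ->] := heckeT_simpleV ss.
rewrite -scalerAl mulrBl heckeT_mull // mulr_algl => ->.
have plv : plen v = (plen (pmul s v)).+1.
  by apply/eqP; rewrite eqn_leq sv andbT -{1}(pmulKs v ss) plen_simple_le.
have ltm' : (plen (pmul s v) < m)%N by lia.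
have := plen_simple_le w ss; have := plen_simple_le (pmul s w) ss; rewrite pmulKs // => lew les.
have sK : cancel (pmul s) (pmul s) by move=> x; apply: pmulKs.
have sE : (pmul s w == pmul s v) = (w == v) by apply: (inj_eq (can_inj sK)).
rewrite !ffunE /GRing.scale /=; case: ifP => [sw|/negbT].
  rewrite IH //; last by lia.
  by rewrite sE addrK mulrA -invfM -exprS -plv.
rewrite -leqNgt => ws; rewrite !IH //; try lia.
rewrite sE; have [wv|wv] := eqVneq w v; first by move: ws; rewrite wv plv; lia.
have [wsv|] := eqVneq w (pmul s v); first by move: vw; rewrite wsv; lia.
by rewrite !mulr0 subr0 mulr0.
Qed.

End HeckeIndicators.

(** * Bar invariance of sums over boards *)

Section BarBoards.
Variables (K : fieldType) (q : K) (n : nat).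
Hypothesis q0 : q != 0.
Implicit Types (g : 'I_n -> nat) (v : 'S_n) (i k : 'I_n).

Lemma fixed_below v (m : nat) : (forall k, (k < m)%N -> (v k <= k)%N) ->
  forall k, (k < m)%N -> v k = k.
Proof.
move=> vk k; have [p] := ubnP (k : nat); elim: p k => // p IH k ltp km.
apply/val_inj; case: (ltngtP (v k) k) (vk _ km) => // lt _.
have /perm_inj e : v (v k) = v k by apply: IH; [apply: leq_trans lt _ | apply: ltn_trans km].
by rewrite e ltnn in lt.
Qed.

Lemma lower2 g i k : lower g i 2 k = lower (lower g i 1) i 1 k.
Proof. by rewrite /lower; case: (k == i); lia. Qed.

Lemma area_lower g i : (i.+1 < g i)%N -> board_area g = (board_area (lower g i 1)).+1.
Proof.
move=> gi; rewrite /board_area (bigD1 i) //= [in RHS](bigD1 i) //= -addSn; congr (_ + _)%N.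
  by rewrite /lower eqxx; lia.
by apply: eq_bigr => k /negbTE ki; rewrite /lower ki subn0.
Qed.

Lemma dyck_fun_lower g i : dyck_fun g -> (i.+1 < g i)%N ->
  (forall k, (k < i)%N -> (g k < g i)%N) -> dyck_fun (lower g i 1).
Proof.
move=> [incg bg] gi gx; split=> [x y xy|k]; rewrite /lower.
  have := incg x y xy; have := gx x; have := bg i; move: xy.
  have [->|xi] := eqVneq x i; have [->|yi] := eqVneq y i; rewrite ?mul1n ?mul0n.
  all: try lia.
  by have : (x != i :> nat) := xi; lia.
by have := bg k; have [->|_] := eqVneq k i; lia.
Qed.

(** Induction on the area: the first column i rising above the diagonal cell gives an exchange
    relation between g and two smaller boards, and comparing this relation with its bar image
    settles g. *)
Lemma bar_board g : dyck_fun g ->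
  bar_sum q (board g) = q ^- board_area g *: indicator q (board g).
Proof.
have [m] := ubnP (board_area g); elim: m g => // m IH g ltm dg; have [incg bg] := dg.
case: (pickP (fun i : 'I_n => i.+1 < g i)%N) => [i0 gi0|g1]; last first.
  have gE k : g k = k.+1 by have := g1 k; have := bg k; lia.
  have bE v : board g v = (v == 1%g).
    apply/boardP/eqP => [vg|-> k]; last by rewrite gE perm1.
    apply/permP=> k; rewrite perm1; apply: (@fixed_below v n) => // x _.
    by rewrite -ltnS; have := vg x; rewrite gE.
  have -> : board_area g = 0%N by apply: big1 => k _; rewrite gE subnn.
  rewrite expr0 invr1 scale1r indicatorE /bar_sum !(big_pred1 _ bE).
  by rewrite /barT invg1 heckeT1 invr1.
case: (@arg_minnP _ i0 (fun i : 'I_n => i.+1 < g i)%N (@nat_of_ord n) gi0) => i gi mini {i0 gi0}.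
(* By minimality of i the earlier columns stop at the diagonal, so their heights are at most j1 = g
   i - 2. *)
have gx k : (k < i)%N -> g k = k.+1.
  by move=> ki; have := bg k; have := mini k; lia.
have j_n : ((g i).-1 < n)%N by have := bg i; lia.
have j1_n : ((g i).-2 < n)%N by lia.
pose j := Ordinal j_n; pose j1 := Ordinal j1_n.
have jj1 : j = j1.+1 :> nat by rewrite /=; lia.
have giE : g i = j.+1 by rewrite /=; lia.
have gxj k : (k < i)%N -> (g k <= j1)%N by move=> ki; rewrite gx //= ; lia.
have ex := exchange_board incg jj1 giE gxj.
have ss : simple_transp (tperm j1 j) by apply/simpleP; exists j1, j.
set s := tperm j1 j in ex ss; set g' := lower g i 1 in ex; set g'' := lower g i 2 in ex.
have dg' : dyck_fun g' by apply: dyck_fun_lower => // k /gxj; lia.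
have area' : board_area g = (board_area g').+1 by apply: area_lower.
have IH' : bar_sum q (board g') = q ^- board_area g' *: indicator q (board g').
  by apply: IH => //; lia.
(* The exponent is the area of g', one more than that of g'' in the nonempty case; the factor q
   makes up for it. *)
have IH'' : bar_sum q (board g'') = q ^- board_area g' *: (q *: indicator q (board g'')).
  have [j1i|ij1] := leqP j1 i.
    (* Here j = i + 1, and [board g''] is empty. *)
    have no v : board g'' v = false.
      apply/negP=> /boardP vg; have vi : (v i < i)%N.
        by have := vg i; rewrite /g'' /lower eqxx; move: j1i => /=; lia.
      (* Columns left of i only allow v k <= k, so v fixes them all, and v i < i collides with one
         of these fixed values. *)
      have /perm_inj e : v (v i) = v i.
        apply: (@fixed_below v i) => // k ki; have := vg k.
        by rewrite /g'' /lower gx // -val_eqE /=; lia.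
      by rewrite e ltnn in vi.
    by rewrite /bar_sum indicatorE !big_pred0 // !scaler0.
  have g'i : (i.+1 < g' i)%N by rewrite /g' /lower eqxx; move: ij1 => /=; lia.
  have g''E : g'' =1 lower g' i 1 by apply: lower2.
  have dg'' : dyck_fun (lower g' i 1).
    apply: dyck_fun_lower => // k ki; have := gxj k ki; move: ij1.
    by rewrite /g' /lower eqxx -val_eqE /=; lia.
  have -> : indicator q (board g'') = indicator q (board (lower g' i 1)).
    exact: eq_indicator (eq_board g''E).
  have -> : bar_sum q (board g'') = bar_sum q (board (lower g' i 1)).
    by apply: eq_bigl => v; apply: eq_board.
  have area'' := area_lower g'i.
  rewrite IH //; last by lia.
  by rewrite area'' scalerA exprS invfM mulrAC mulVf // mul1r.
(* With the induction hypotheses, the relation and its bar image have proportional left-hand sides,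
   and the terms in g'' cancel. *)
have := bar_sum_exchange q0 ss ex; rewrite IH' IH''.
have := indicator_exchange q (fun u => pmulKs u ss) (fun u => plen_simple_neql u ss) ex.
rewrite linearZ_LR /= -scalerDr => ->.
rewrite area' exprS invfM.

by rewrite !scalerDr !scalerA => /addIr <-.
Qed.
End BarBoards.

(** * Kazhdan-Lusztig polynomials of Dyck permutations *)

Section ExchangeTop.
Variables (n : nat) (sigma : 'S_n -> 'S_n) (w w' w'' : 'S_n).
Hypothesis sigmaK : involutive sigma.
Hypothesis plen_sigma : forall u, plen (sigma u) != plen u.
Hypothesis plen_sigma_le : forall u, (plen (sigma u) <= (plen u).+1)%N.
Hypothesis ex : exchange sigma ((@bruhat_le n)^~ w) ((@bruhat_le n)^~ w') ((@bruhat_le n)^~ w'').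
Hypothesis lw : plen w = (plen w').+1.
Hypothesis lw' : plen w' = (plen w'').+1.

Let down u : (plen u < plen (sigma u))%N = false -> (plen (sigma u) < plen u)%N.
Proof. by case: ltngtP (plen_sigma u). Qed.

(** If w were shorter than sigma w, [exchange] would put w below w'. So sigma w is the shorter one;
    it lies below w' and has at least its length. *)
Lemma exchange_top : sigma w' = w.
Proof.
case: (boolP (plen w < plen (sigma w))%N) => [/ex[+ _ _ _]|/negbTE/down lt].
  by rewrite bruhat_le_refl => /esym/bruhat_le_plenW; rewrite lw ltnn.
have [] := ex (u := sigma w); rewrite sigmaK // => _ + _ _; rewrite bruhat_le_refl => /esym le.
rewrite -[RHS]sigmaK; congr sigma; apply/esym/bruhat_le_eq => //.
by apply/eqP; rewrite eqn_leq bruhat_le_plenW //= -ltnS -lw -{1}[w]sigmaK plen_sigma_le.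
Qed.

Lemma exchange_bottom_down : (plen (sigma w'') < plen w'')%N.
Proof.
case: (boolP (plen w'' < plen (sigma w''))%N) => [lt|/negbTE/down //].
have [_ _ e1 e2] := ex lt; have := bruhat_le_plenW (u := sigma w'') (v := w'').
by rewrite e2 -e1 bruhat_le_refl => /(_ isT); rewrite leqNgt lt.
Qed.

Lemma exchange_bottom_lt : bruhat_lt w'' w'.
Proof.
have := exchange_bottom_down; have [] := ex (u := sigma w''); rewrite sigmaK.
  exact: exchange_bottom_down.
by move=> _ _ _; rewrite bruhat_le_refl bruhat_ltE ?lw'.
Qed.

(** By [exchange], v lies below w'', which has the same length. Hence only w'' contributes to the
    sum in the product formula. *)
Lemma exchange_bottom v : bruhat_le v w' -> (plen (sigma v) < plen v)%N ->
  (plen v).+1 = plen w' -> v = w''.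
Proof.
move=> vw' lt lv; have [] := ex (u := sigma v); rewrite sigmaK // => _ _ _.
by rewrite vw' => /bruhat_le_eq; apply; move: lv; rewrite lw' => -[].
Qed.

End ExchangeTop.

Lemma qh_neq0 : qh != 0.
Proof. by rewrite /qh tofrac_eq0 polyX_eq0. Qed.

Lemma q_neq0 : q != 0.
Proof. by rewrite /q expf_neq0 // qh_neq0. Qed.

(** Clears the half powers in the coordinate equation of [KL_eq1], with h = q^(1/2). *)
Lemma half_power_eq (K : fieldType) (h a b : K) (l m : nat) : h != 0 -> (m <= l)%N ->
  h ^+ l * a * (h ^+ 2) ^- m = h ^- l * b -> a * (h ^+ 2) ^+ (l - m) = b.
Proof.
move=> h0 ml; rewrite -{1 2}(subnKC ml) !exprD !(exprAC h 2).
have := expf_neq0 m h0; have := expf_neq0 (l - m) h0.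
move: (h ^+ m) (h ^+ (l - m)) => x y y0 x0 e.
have -> : b = (x * y) * ((x * y)^-1 * b) by rewrite mulVKf // mulf_neq0.
by rewrite -e; field.
Qed.

Lemma polyval_sum (p : {poly int}) (a : Fq) :
  polyval p a = \sum_(i < size p) (p`_i)%:~R * a ^+ i.
Proof.
rewrite /polyval (horner_coef_wide _ (size_poly _ _)).
by apply: eq_bigr => i _; rewrite coef_map_id0.
Qed.

Lemma polyvalB1 (p : {poly int}) (a : Fq) : polyval (p - 1) a = polyval p a - 1.
Proof. by rewrite /polyval rmorphB /= rmorph1 !hornerE. Qed.

(* p(1/q) q^d only involves powers of q larger than the degree of p. *)
Lemma polyval_sym (p : {poly int}) (d : nat) : ((size p).-1.*2 + 1 <= d)%N ->
  polyval p q^-1 * q ^+ d = polyval p q -> p = 0.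
Proof.
move=> pd; rewrite !polyval_sum.
(* [A] and [B] are the two sides as polynomials in q^(1/2), whence the doubled exponents. *)
pose A : {poly rat} := \sum_(i < size p) ((p`_i)%:~R)%:P * 'X^((d - i).*2).
pose B : {poly rat} := \sum_(i < size p) ((p`_i)%:~R)%:P * 'X^(i.*2).
have qE (m : nat) : q ^+ m = tofrac ('X^(m.*2) : {poly rat}).
  by rewrite /q /qh -exprM mul2n rmorphXn.
have cE (c : int) : c%:~R = tofrac ((c%:~R)%:P : {poly rat}) by rewrite !rmorph_int.
have -> : \sum_(i < size p) (p`_i)%:~R * q ^+ i = tofrac B.
  by rewrite rmorph_sum; apply: eq_bigr => i _; rewrite rmorphM /= -qE -cE.
have -> : (\sum_(i < size p) (p`_i)%:~R * q^-1 ^+ i) * q ^+ d = tofrac A.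
  rewrite rmorph_sum mulr_suml; apply: eq_bigr => i _; rewrite rmorphM /= -qE -cE -mulrA.
  congr (_ * _); have id : (i <= d)%N by have := ltn_ord i; lia.
  by rewrite -{1}(subnK id) exprD mulrCA exprVn mulVf ?mulr1 // expf_neq0 // q_neq0.
move/eqP; rewrite tofrac_eq => /eqP AB; apply/polyP=> k; rewrite coef0.
have [kp|] := ltnP k (size p); last by move/(nth_default 0).
(* In degree 2k with k < [size p], [A] has no term since every d - i exceeds k, while [B] has the
   coefficient of p. *)
have := congr1 (fun r : {poly rat} => r`_(k.*2)) AB; rewrite !coef_sum.
rewrite big1 => [|i _]; last by rewrite coefMXn ifT //; have := ltn_ord i; lia.
rewrite (bigD1 (Ordinal kp)) //= big1 => [|i ik].
  rewrite coefMXn ltnn subnn coefC eqxx addr0 => /esym/eqP.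
  by rewrite intr_eq0 => /eqP.
rewrite coefMXn coefC; case: ifP => // /negbT ki; case: eqP => // e.
by case/eqP: ik; apply/val_inj => /=; lia.
Qed.

(** * Uniqueness of the Kazhdan-Lusztig polynomials *)

Section KLUnique.
Variable n : nat.
Implicit Types (s u v w x : 'S_n) (P : 'S_n -> 'S_n -> {poly int}).

Lemma kl_cE w : kl_c w = indicator q ((@bruhat_le n)^~ w).
Proof. by rewrite indicatorE. Qed.

(** Bar invariance of q^(-l(w)/2) c_w, rescaled so that no half power occurs. *)
Definition bar_invariant w : Prop :=
  bar_sum q ((@bruhat_le n)^~ w) = q ^- plen w *: kl_c w.

Lemma bar_invariant_dyck G w : dyck G -> associated G w -> bar_invariant w.
Proof.
move=> dG Gw; have dg := bound_dyck_fun dG.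
have E : (@bruhat_le n)^~ w =1 board (bound G).
  by move=> v; rewrite (bruhat_graph_board v dG Gw) graph_boardE.
rewrite /bar_invariant kl_cE (eq_indicator _ E) /bar_sum (eq_bigl _ _ E).
rewrite -/(bar_sum _ _) (bar_board q_neq0 dg); congr (q ^- _ *: _).
by rewrite (plen_associated Gw) nedges_code; apply: eq_bigr => k _; rewrite /bound addnK.
Qed.

Lemma kl_c_simple s : simple_transp s -> kl_c s = 1 + heckeT q s.
Proof.
move=> ss; rewrite /kl_c (bigD1 s) ?bruhat_le_refl //= addrC -heckeT1; congr (_ + _).
rewrite (big_pred1 1%g) // => v; rewrite bruhat_le_simple //= /pred1 /=.
have s1 : (s == 1%g) = false.
  by apply/eqP=> s1; have := plen_simple ss; rewrite s1 plen1.
by case: (eqVneq v s) => [->|_]; rewrite ?s1 ?andbF // andbT.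
Qed.

Lemma bar_invariant_simple s : simple_transp s -> bar_invariant s.
Proof.
move=> ss; rewrite /bar_invariant kl_c_simple // plen_simple // /bar_sum.
have -> : \sum_(v | bruhat_le v s) barT q v = 1 + barT q s.
  rewrite (bigD1 s) ?bruhat_le_refl //= addrC; congr (_ + _).
  rewrite (big_pred1 1%g) => [|v]; first by rewrite /barT invg1 heckeT1 invr1.
  rewrite bruhat_le_simple //= /pred1 /=.
  have s1 : (s == 1%g) = false.
    by apply/eqP=> s1; have := plen_simple ss; rewrite s1 plen1.
  by case: (eqVneq v s) => [->|_]; rewrite ?s1 ?andbF // andbT.
by rewrite /barT simpleV // heckeT_simpleV_add1 // q_neq0.
Qed.

(** Induction on l(w) - l(x): the bar invariances of C'_w and of q^(-l(w)/2) c_w are compared on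
    T_x, and the degree bound kills the difference P_{x,w} - 1 through [polyval_sym]. *)
Lemma KL_eq1 P w : KL_polynomials P -> bar_invariant w ->
  forall v, bruhat_le v w -> P v w = 1.
Proof.
case=> P1 P0 Pdeg Pbar inv x; have [m] := ubnP (plen w - plen x)%N.
elim: m x => // m IH x ltm xw.
have [->|xw1] := eqVneq x w; first exact: P1.
have xlt : bruhat_lt x w by rewrite /bruhat_lt xw1.
have lxw := bruhat_lt_plen xlt; have deg := Pdeg _ _ xlt.
set l := plen w in ltm lxw deg inv *.
have e1 : \sum_(v | bruhat_le v w) barT q v x = q ^- l.
  have := congr1 (fun y : hecke q n => y x) inv.
  by rewrite /bar_sum sum_ffunE ffunE kl_cE ffunE xw /GRing.scale /= mulr1.
have e2 : \sum_(v | bruhat_le v w) qh ^+ l * polyval (P v w) q^-1 * barT q v x =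
    qh ^- l * polyval (P x w) q.
  have := congr1 (fun y : hecke q n => y x) (Pbar w).
  rewrite /bar_KLC /KLC !sum_ffunE [RHS in _ = RHS -> _](bigD1 x) //=.
  rewrite [X in _ = _ + X]big1 => [|v /andP[_ vx]]; last first.
    by rewrite !ffunE eq_sym (negbTE vx) scaler0.
  rewrite !ffunE eqxx addr0 /GRing.scale /= mulr1 => <-.
  by apply: eq_bigr => v _; rewrite !ffunE.
have e3 : \sum_(v | bruhat_le v w) qh ^+ l * polyval (P v w - 1) q^-1 * barT q v x =
    qh ^- l * polyval (P x w - 1) q.
  under eq_bigr => v _ do rewrite polyvalB1 mulrBr mulrBl mulr1.
  rewrite big_split /= sumrN -mulr_sumr e1 e2 polyvalB1 mulrBr mulr1; congr (_ - _).
  by rewrite /q -exprM mul2n -addnn exprD invfM mulVKf // expf_neq0 // qh_neq0.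
(* Only v = x survives: longer v have P_{v,w} = 1 by induction, and the others vanish at x by
   triangularity. *)
rewrite (bigD1 x) //= big1 ?addr0 in e3; last first.
  move=> v /andP[vw vx]; have [xv|vx'] := ltnP (plen x) (plen v).
    have lv := bruhat_le_plenW vw.
    by rewrite IH //; [rewrite polyvalB1 /polyval rmorph1 hornerE subrr mulr0 mul0r | lia].
  by rewrite (barT_coord q_neq0) // eq_sym (negbTE vx) !mulr0.
rewrite (barT_coord q_neq0) // eqxx mulr1 in e3.
apply/eqP; rewrite -subr_eq0; apply/eqP/(@polyval_sym _ (l - plen x)).
  apply: leq_trans deg; rewrite leq_add2r leq_double.
  have := size_polyD (P x w) (- 1); rewrite size_polyN size_poly1 leq_max.
  by move: (size _) (size _) => a b; lia.
exact: (half_power_eq qh_neq0 (ltnW lxw) e3).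
Qed.

Lemma KL_mu1 P v w : P v w = 1 -> (plen v < plen w)%N ->
  KL_mu P v w = ((plen v).+1 == plen w)%:R.
Proof.
move=> Pvw lt; rewrite /KL_mu Pvw coef1; case: ifP => o; last first.
  by case: eqP => // e; rewrite -e subSnn in o.
congr _%:R; congr nat_of_bool; apply/eqP/eqP => e; last by rewrite -e subSnn.
by move: o; have := odd_double_half (plen w - plen v); lia.
Qed.

Lemma KLC_kl_c P w : KL_polynomials P -> bar_invariant w ->
  KLC P w = qh ^- plen w *: kl_c w.
Proof.
move=> KL inv; rewrite /KLC /kl_c scaler_sumr; apply: eq_bigr => v vw.
by rewrite (KL_eq1 KL inv vw) /polyval rmorph1 hornerE mulr1.
Qed.

End KLUnique.

Section KLInstance.
Variables (n : nat) (sigma : 'S_n -> 'S_n) (s w w' w'' : 'S_n).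
Hypothesis ss : simple_transp s.
Hypothesis sigmaK : involutive sigma.
Hypothesis plen_sigma : forall u, plen (sigma u) != plen u.
Hypothesis plen_sigma_le : forall u, (plen (sigma u) <= (plen u).+1)%N.
Hypothesis bruhat_sigma : forall u, bruhat_lt u (sigma u) = (plen u < plen (sigma u))%N.
Hypothesis ex : exchange sigma ((@bruhat_le n)^~ w) ((@bruhat_le n)^~ w') ((@bruhat_le n)^~ w'').
Hypothesis lw : plen w = (plen w').+1.
Hypothesis lw' : plen w' = (plen w'').+1.
Hypothesis inv : forall u, u \in [:: s; w; w'; w''] -> bar_invariant u.
Variable P : 'S_n -> 'S_n -> {poly int}.
Hypothesis KL : KL_polynomials P.

Lemma KL_mu_exchange v : bruhat_lt v w' -> bruhat_lt (sigma v) v ->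
  KL_mu P v w' = (v == w'')%:R.
Proof.
move=> vw' /bruhat_lt_plen lt; have [_ le] := andP vw'.
rewrite KL_mu1 ?bruhat_lt_plen //; last by apply: KL_eq1 => //; apply: inv; rewrite !inE eqxx !orbT.
congr _%:R; congr nat_of_bool; apply/eqP/eqP => [e|->]; last by rewrite lw'.
exact: (exchange_bottom sigmaK ex lw' le lt).
Qed.

(* [prod] stands for the product of C'_s and C'_w' on the relevant side. *)
Lemma KLC_exchange (prod : hecke q n) :
  prod = qh ^- (plen s + plen w') *: (kl_c w + q *: kl_c w'') ->
  [/\ bruhat_lt w' (sigma w') /\ sigma w' = w,
      bruhat_lt w'' w' /\ bruhat_lt (sigma w'') w'',
      forall v, bruhat_lt v w' -> bruhat_lt (sigma v) v ->
        KL_mu P v w' = (v == w'')%:R,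
      prod = KLC P (sigma w') +
        \sum_(v | bruhat_lt v w' && bruhat_lt (sigma v) v)
           (KL_mu P v w')%:~R *: KLC P v
    & forall u, u \in [:: s; w; w'; w''] -> kl_c u = qh ^+ plen u *: KLC P u].
Proof.
have sw' := exchange_top sigmaK plen_sigma plen_sigma_le ex lw.
have dw'' := exchange_bottom_down plen_sigma ex.
have bw'' : bruhat_lt (sigma w'') w''.
  by have := bruhat_sigma (sigma w''); rewrite sigmaK dw''.
have ltw'' := exchange_bottom_lt sigmaK plen_sigma ex lw'.
have KLCE u : u \in [:: s; w; w'; w''] -> KLC P u = qh ^- plen u *: kl_c u.
  by move=> /inv/(KLC_kl_c KL).
move=> ->; split.
- by split; rewrite // bruhat_sigma sw' lw.
- by split.
- exact: KL_mu_exchange.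
- rewrite sw' (bigD1 w'') ?ltw'' //= big1 => [|v /andP[/andP[vw' vd] vw'']]; last first.
    by rewrite KL_mu_exchange // (negbTE vw'') scale0r.
  have -> : KL_mu P w'' w' = 1 by rewrite (KL_mu_exchange ltw'' bw'') eqxx.
  rewrite mulr1z scale1r addr0 (KLCE w); last by rewrite !inE eqxx orbT.
  rewrite (KLCE w''); last by rewrite !inE eqxx !orbT.
  (* The exponent 1 + l(w') is l(w), and l(w) = l(w'') + 2, so the factor q turns the normalization
     of w into that of w''. *)
  rewrite plen_simple // scalerDr scalerA add1n -lw; congr (_ + _ *: _).
  by rewrite lw lw' -addn2 exprD invfM mulfVK // expf_neq0 // qh_neq0.
- by move=> u uin; rewrite KLCE // scalerA divff ?scale1r // expf_neq0 // qh_neq0.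
Qed.

End KLInstance.

(** * Chromatic quasi-symmetric functions *)

Section ColoringWeights.
Variables (K : comNzRingType) (T : Type) (n : nat) (phi : T -> T -> K).
Implicit Types (G H : rel 'I_n) (c : 'I_n -> T) (i j k l x y : 'I_n).

(** With [color_weight] for [phi] this is q^asc on proper colorings and 0 on the others; the product
    form isolates the removed edges. *)
Definition weight G c : K :=
  \prod_(p : 'I_n * 'I_n | (p.1 < p.2)%N && G p.1 p.2) phi (c p.1) (c p.2).

Lemma eq_weight G H c : G =2 H -> weight G c = weight H c.
Proof. by move=> e; apply: eq_bigl => p; rewrite e. Qed.

Lemma weight_del_edge G i j c : (i < j)%N -> G i j ->
  weight G c = phi (c i) (c j) * weight (del_edge G i j) c.
Proof.
move=> ij Gij; rewrite /weight (bigD1 (i, j)) /= ?ij ?Gij //; congr (_ * _).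
apply: eq_bigl => -[x y] /=; have [xy|//] := ltnP x y.
by rewrite del_edgeE.
Qed.

Definition twins G k l : Prop := G k l /\ forall x y,
  (x < y)%N -> (x, y) != (k, l) -> G (tperm k l x) (tperm k l y) = G x y.

(** As l = k + 1, the transposition (k l) permutes the edges other than {k, l} and keeps their
    orientation; their product is the common factor r. *)
Lemma weight_twins G k l c : l = k.+1 :> nat -> twins G k l ->
  exists r, weight G c = phi (c k) (c l) * r /\
    weight G (c \o tperm k l) = phi (c l) (c k) * r.
Proof.
move=> kl [Gkl tw]; have ltkl : (k < l)%N by rewrite kl.
exists (weight (del_edge G k l) c); rewrite -weight_del_edge //; split=> //.
rewrite (weight_del_edge _ ltkl) //= tpermL tpermR; congr (_ * _).
pose f (p : 'I_n * 'I_n) := (tperm k l p.1, tperm k l p.2).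
have fK : involutive f by move=> [x y]; rewrite /f /= !tpermK.
rewrite /weight [RHS](reindex_inj (inv_inj fK)) /=; apply: eq_bigl => -[x y] /=.
have lt (a b : 'I_n) : (a < b)%N -> (a, b) != (k, l) -> (tperm k l a < tperm k l b)%N.
  exact: tperm_adj_lt.
have tn (a b : 'I_n) : (a < b)%N -> (a, b) != (k, l) -> (tperm k l a, tperm k l b) != (k, l).
  move=> ab nab; apply/negP; rewrite xpair_eqE => /andP[/eqP/(canRL (tpermK k l)) ak].
  move=> /eqP/(canRL (tpermK k l)) bl; move: ab.
  by rewrite ak bl tpermL tpermR ltnNge ltnW.
apply/andP/andP => [[xy]|[]].
  rewrite del_edgeE // => /andP[Gxy nxy]; have txy := lt _ _ xy nxy.
  by rewrite del_edgeE // txy tw // Gxy tn.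
move=> txy; rewrite del_edgeE // => /andP[Gxy nxy].
have := lt _ _ txy nxy; have := tn _ _ txy nxy; have := tw _ _ txy nxy.
by rewrite !tpermK => GE nxy' xy; rewrite xy del_edgeE // GE Gxy.
Qed.

Lemma weight_mirror G c : symmetric G -> weight (mirror G) c =
  \prod_(p : 'I_n * 'I_n | (p.1 < p.2)%N && G p.1 p.2)
     phi (c (rev_ord p.2)) (c (rev_ord p.1)).
Proof.
move=> Gs; pose f (p : 'I_n * 'I_n) := (rev_ord p.2, rev_ord p.1).
have fK : involutive f by move=> [x y]; rewrite /f /= !rev_ordK.
rewrite /weight (reindex_inj (inv_inj fK)) /=; apply: eq_bigl => -[x y].
by rewrite /f [(_, _).1]/= [(_, _).2]/= ltn_rev_ord /mirror !rev_ordK Gs.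
Qed.

Variable q : K.
(** Lee's relation on the vertices i, j1, j with colors z, a, b, summed with its image under the
    exchange of a and b. *)
Hypothesis phi3 : forall a b z, (q + 1) * (phi a b * phi z a + phi b a * phi z b) =
  (phi a b + phi b a) * (phi z a * phi z b) + q * (phi a b + phi b a).

(** In G'' the vertices j1 and j are twins, so its edges other than {j1, j} contribute a common
    factor and [phi3] remains. *)
Lemma weight_first G G' G'' : lee_first G G' G'' -> exists k l, forall c,
  let t := tperm k l in
  (q + 1) * (weight G' c + weight G' (c \o t)) =
    weight G c + weight G (c \o t) + q * (weight G'' c + weight G'' (c \o t)).
Proof.
case/lee_first_bounds=> i [j1 [j [[jj1 ij1 Gij G'ij1] [bi bx bj] [dG _ _] G'E G''E]]].
exists j1, j => c t.
have ij : (i < j)%N by rewrite jj1 ltnS ltnW.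
have [nij1 nij] : i != j1 /\ i != j by rewrite -!val_eqE /=; lia.
have [incb _] := bound_dyck_fun dG.
pose G2 := del_edge (del_edge G i j) i j1.
have G2E x y : (x < y)%N -> G2 x y = (y < bound G x)%N && ((x != i) || (y < j1)%N).
  move=> xy; rewrite /G2 !del_edgeE // dyck_edgeE // !xpair_eqE.
  case: (eqVneq x i) => [->|_]; last by rewrite !andbT.
  by rewrite bi -!val_eqE /= jj1; lia.
(* Columns before i reach neither j1 nor j, columns after i reach both, and i has lost both
   edges. *)
have col x : (x < j1)%N -> G2 x j = G2 x j1.
  move=> xj1; rewrite !G2E //; last by rewrite jj1 ltnS ltnW.
  rewrite -val_eqE /=; have := bx x; have := incb i x; rewrite bi jj1.
  by case: (ltngtP x i); lia.
have tw : twins G2 j1 j.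
  split=> [|x y xy nxy].
    by rewrite G2E; [rewrite eq_sym nij1 bj bound_gt | rewrite jj1].
  have txy := tperm_adj_lt jj1 xy nxy; move: txy.
  have [nj1i nji] : (j1 == i) = false /\ (j == i) = false.
    by rewrite ![_ == i]eq_sym (negbTE nij1) (negbTE nij).
  case: (tpermP j1 j x) => [xE|xE|/eqP xj1 /eqP xj].
  - have yj : j != y by apply: contra nxy => /eqP <-; rewrite xE.
    have yj1 : j1 != y by rewrite neq_ltn -xE xy.
    by rewrite tpermD // => jy; rewrite xE !G2E -?xE // xE bj nj1i nji.
  - have yj : j != y by rewrite neq_ltn -xE xy.
    have yj1 : j1 != y by rewrite neq_ltn; move: xy; rewrite xE jj1 => /ltnW ->.
    by rewrite tpermD // => jy; rewrite xE !G2E -?xE // xE bj nj1i nji.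
  - case: (tpermP j1 j y) => [yE|yE|//] _; rewrite yE col //; first by rewrite -yE.
    by move: xy; rewrite yE jj1 ltnS leq_eqVlt (inj_eq val_inj) (negbTE xj1).
have [r [w1 w2]] := weight_twins c jj1 tw.
rewrite !(eq_weight _ G'E) !(eq_weight _ G''E) !(weight_del_edge _ ij Gij) !(weight_del_edge _ ij1 G'ij1).
rewrite w1 w2 /t /= tpermL tpermR tpermD 1?eq_sym //.
have := congr1 ( *%R^~ r) (phi3 (c j1) (c j) (c i)).
move: (phi (c j1) (c j)) (phi (c j) (c j1)) (phi (c i) (c j1)) (phi (c i) (c j)) => a b d e /= E.
have -> : (q + 1) * (d * (a * r) + e * (b * r)) = (q + 1) * (a * d + b * e) * r by ring.
by rewrite E; ring.
Qed.

End ColoringWeights.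

Section Chromatic.
Variable n : nat.
Implicit Types (G H : rel 'I_n).

(* [lt] is the order of the colors, reversed when passing to the mirror image. *)
Definition color_weight (lt : rel nat) (m : {cmonom nat}) (a b : finsupp m) : Fq :=
  if val a == val b then 0 else if lt (val a) (val b) then q else 1.

Definition monomial (m : {cmonom nat}) (c : {ffun 'I_n -> finsupp m}) : {cmonom nat} :=
  \big[mmul/mone]_i ucm (val (c i)).

Definition chromatic_weight lt G (m : {cmonom nat}) : Fq :=
  \sum_(c : {ffun 'I_n -> finsupp m} | monomial c == m) weight (color_weight lt (m := m)) G c.

Lemma chromaticE G m : symmetric G -> irreflexive G ->
  chromatic G m = chromatic_weight ltn G m.
Proof.
move=> Gs Gi; rewrite /chromatic big_mkcondl; apply: eq_bigr => c _; rewrite /weight.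
case: ifP => [/forallP proper|/negbT].
  rewrite -prodr_const.
  rewrite (eq_bigl (fun p : 'I_n * 'I_n => ((p.1 < p.2)%N && G p.1 p.2) && (val (c p.1) < val (c p.2))%N)).
    rewrite big_mkcondr; apply: eq_bigr => -[x y] /= /andP[xy Gxy].
    have /implyP/(_ Gxy) := forallP (proper x) y; rewrite -val_eqE /color_weight /=.
    by move/negbTE ->.
  by move=> p; rewrite inE andbA.
rewrite negb_forall => /existsP[x]; rewrite negb_forall => /existsP[y].
rewrite negb_imply negbK => /andP[Gxy /eqP cxy].
case: (ltngtP x y) => xy.
- by rewrite (bigD1 (x, y)) /= ?xy ?Gxy // /color_weight cxy eqxx mul0r.
- by rewrite (bigD1 (y, x)) /= ?xy 1?Gs ?Gxy // /color_weight cxy eqxx mul0r.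
- by move: Gxy; rewrite (val_inj xy) Gi.
Qed.

Lemma eq_chromatic G H m : G =2 H -> chromatic G m = chromatic H m.
Proof.
move=> e; apply: eq_big => [c|c _].
  by congr (_ && _); apply: eq_forallb => x; apply: eq_forallb => y; rewrite e.
by congr (q ^+ _); apply: eq_card => p; rewrite !inE e.
Qed.

Lemma sum_permute (m : {cmonom nat}) (f : 'I_n -> 'I_n) (F : {ffun 'I_n -> finsupp m} -> Fq) :
  involutive f ->
  \sum_(c | monomial c == m) F c = \sum_(c | monomial c == m) F [ffun x => c (f x)].
Proof.
move=> fK; pose h (c : {ffun 'I_n -> finsupp m}) := [ffun x => c (f x)].
have hK : involutive h by move=> c; apply/ffunP=> x; rewrite !ffunE fK.
rewrite (reindex_inj (inv_inj hK)); apply: eq_bigl => c; congr (_ == _).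
rewrite /monomial [RHS](reindex_inj (inv_inj fK)).
by apply: eq_bigr => x _; rewrite ffunE.
Qed.

Lemma chromatic_weight_first lt G G' G'' m :
  (forall a b, a != b -> lt a b = ~~ lt b a) -> transitive lt ->
  lee_first G G' G'' ->
  (q + 1) * chromatic_weight lt G' m =
    chromatic_weight lt G m + q * chromatic_weight lt G'' m.
Proof.
move=> ltN ltT lee.
have phi3 (a b z : finsupp m) : let phi := @color_weight lt m in
  (q + 1) * (phi a b * phi z a + phi b a * phi z b) =
  (phi a b + phi b a) * (phi z a * phi z b) + q * (phi a b + phi b a).
  rewrite /color_weight /=; move: (val a) (val b) (val z) => {}a {}b {}z.
  move: q => q.
  have [->|ab] := eqVneq a b; first by rewrite ?eqxx; ring.
  rewrite (ltN a b ab).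
  have [->|za] := eqVneq z a.
    by rewrite ?(negbTE ab) (ltN a b ab); case: (lt b a) => /=; ring.
  have [->|zb] := eqVneq z b.
    by case: (lt b a) => /=; ring.
  case lba: (lt b a) => /=.
    case lzb: (lt z b); first by rewrite (ltT _ _ _ lzb lba); ring.
    by case: (lt z a); ring.
  have lab : lt a b by rewrite ltN // lba.
  case lza: (lt z a); first by rewrite (ltT _ _ _ lza lab); ring.
  by case: (lt z b); ring.
have [k [l W]] := weight_first phi3 lee.
pose t := tperm k l; have tK : involutive t := tpermK k l.
(* Composition with t preserves the monomial, so pairing each coloring with its composition counts
   the sum twice; 2 is nonzero in the field. *)
have S H : 2 * chromatic_weight lt H m = \sum_(c : {ffun 'I_n -> finsupp m} | monomial c == m)
    (weight (color_weight lt (m := m)) H c + weight (color_weight lt (m := m)) H (c \o t)).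
  rewrite big_split /= mulr2n mulrDl !mul1r; congr (_ + _).
  rewrite /chromatic_weight (sum_permute _ tK); apply: eq_bigr => c _.
  by apply: eq_bigr => p _; rewrite !ffunE.
have two0 : (2 : Fq) != 0.
  have -> : (2 : Fq) = tofrac (2%:R : {poly rat}) by rewrite rmorph_nat.
  by rewrite tofrac_eq0 -(rmorph_nat polyC) polyC_eq0.
apply: (mulfI two0); rewrite mulrDr !(mulrCA 2) !S !mulr_sumr -big_split /=.
by apply: eq_bigr => c _; rewrite W.
Qed.

Lemma chromatic_first G G' G'' m : lee_first G G' G'' ->
  (q + 1) * chromatic G' m = chromatic G m + q * chromatic G'' m.
Proof.
move=> lee; have [_ [_ [[Gs Gi _] [Gs' Gi' _] [Gs'' Gi'' _]] _ _ _]] := exchange_first lee.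
rewrite !chromaticE //; apply: chromatic_weight_first => //.
  by move=> a b ab; rewrite /= -leqNgt (leq_eqVlt a) (negbTE ab).
by move=> a b c; apply: ltn_trans.
Qed.

(** Reversing the vertices turns ascents into descents, that is, reverses the order of the colors;
    this is why [lt] is a parameter. *)
Lemma chromatic_weight_mirror H m : symmetric H ->
  chromatic_weight ltn (mirror H) m = chromatic_weight (fun a b => b < a)%N H m.
Proof.
move=> Hs; rewrite /chromatic_weight (sum_permute _ (@rev_ordK n)).
apply: eq_bigr => c _; rewrite weight_mirror //; apply: eq_bigr => p _.
by rewrite !ffunE !rev_ordK /color_weight eq_sym.
Qed.

Lemma chromatic_second G G' G'' m : lee_second G G' G'' ->
  (q + 1) * chromatic G' m = chromatic G m + q * chromatic G'' m.
Proof.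
case=> [H [H' [H'' [lee [GE G'E G''E]]]]].
have [_ [_ [dH dH' dH''] _ _ _]] := exchange_first lee.
have [[Hs _ _] [Hs' _ _] [Hs'' _ _]] := And3 dH dH' dH''.
have [Ms Mi _] := mirror_dyck dH; have [Ms' Mi' _] := mirror_dyck dH'.
have [Ms'' Mi'' _] := mirror_dyck dH''.
rewrite (eq_chromatic _ GE) (eq_chromatic _ G'E) (eq_chromatic _ G''E).
rewrite !chromaticE // !chromatic_weight_mirror //; apply: chromatic_weight_first => //.
  by move=> a b ab; rewrite -leqNgt (leq_eqVlt b) eq_sym (negbTE ab).
by move=> a b c ba cb; apply: ltn_trans cb ba.
Qed.

End Chromatic.

(** * Product formulas *)

Section LeeProducts.
Variable n : nat.
Implicit Types (G : rel 'I_n) (s w : 'S_n).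

Lemma kl_c_mull s w : simple_transp s ->
  kl_c s * kl_c w = kl_c w + hecke_act (pmul s) (kl_c w).
Proof. by move=> ss; rewrite (kl_c_simple ss) mulrDl mul1r heckeT_mull. Qed.

Lemma kl_c_mulr s w : simple_transp s ->
  kl_c w * kl_c s = kl_c w + hecke_act ((@pmul n)^~ s) (kl_c w).
Proof. by move=> ss; rewrite (kl_c_simple ss) mulrDr mulr1 heckeT_mulr. Qed.

Lemma bruhat_exchange sigma G G' G'' w w' w'' :
  [/\ dyck G, dyck G' & dyck G''] ->
  associated G w -> associated G' w' -> associated G'' w'' ->
  exchange sigma (graph_board G) (graph_board G') (graph_board G'') ->
  exchange sigma ((@bruhat_le n)^~ w) ((@bruhat_le n)^~ w') ((@bruhat_le n)^~ w'').
Proof.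
by move=> [dG dG' dG''] Gw Gw' Gw''; apply: eq_exchange => v; apply/esym/bruhat_graph_board.
Qed.

Lemma bar_invariant_triple G G' G'' s w w' w'' : simple_transp s ->
  [/\ dyck G, dyck G' & dyck G''] ->
  associated G w -> associated G' w' -> associated G'' w'' ->
  forall u, u \in [:: s; w; w'; w''] -> bar_invariant u.
Proof.
move=> ss [dG dG' dG''] Gw Gw' Gw'' u; rewrite !inE => /or4P[] /eqP ->.
- exact: bar_invariant_simple.
- exact: bar_invariant_dyck Gw.
- exact: bar_invariant_dyck Gw'.
- exact: bar_invariant_dyck Gw''.
Qed.

Lemma lee_first_product G G' G'' w w' w'' : lee_first G G' G'' ->
  associated G w -> associated G' w' -> associated G'' w'' ->
  exists2 s, simple_transp s &
    [/\ kl_c s * kl_c w' = kl_c w + q *: kl_c w'',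
        kl_c w' * kl_c s = (q + 1) *: kl_c w'
      & forall P, KL_polynomials P -> KL_instance_left P s w w' w''].
Proof.
move=> /exchange_first[s [ss dyckG ex cl [e e']]] Gw Gw' Gw''; exists s => //.
have [dG dG' dG''] := dyckG.
have {}ex := bruhat_exchange dyckG Gw Gw' Gw'' ex.
have lw : plen w = (plen w').+1 by rewrite (plen_associated Gw) (plen_associated Gw').
have lw' : plen w' = (plen w'').+1 by rewrite (plen_associated Gw') (plen_associated Gw'').
have sK : involutive (pmul s) by move=> u; rewrite pmulKs.
have sN u := plen_simple_neql u ss.
have prod : kl_c s * kl_c w' = kl_c w + q *: kl_c w''.
  by rewrite (kl_c_mull _ ss) !kl_cE (indicator_exchange q sK sN ex).
split=> // [|P KL].
  rewrite (kl_c_mulr _ ss) !kl_cE indicator_closed // => u.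
  by rewrite !(bruhat_graph_board _ dG' Gw').
have inv := bar_invariant_triple ss dyckG Gw Gw' Gw''.
apply: (KLC_exchange ss sK sN _ _ ex lw lw' inv KL) => [u|u|].
- exact: plen_simple_le.
- exact: bruhat_ltl.
(* All elements involved satisfy C'_u = q^(-l(u)/2) c_u, so this is a rescaling of [prod]. *)
- rewrite !KLC_kl_c //; try by apply: inv; rewrite !inE eqxx ?orbT.
  by rewrite -scalerAl -scalerAr prod scalerA exprD invfM.
Qed.

Lemma lee_second_product G G' G'' w w' w'' : lee_second G G' G'' ->
  associated G w -> associated G' w' -> associated G'' w'' ->
  exists2 s, simple_transp s &
    [/\ kl_c w' * kl_c s = kl_c w + q *: kl_c w'',
        kl_c s * kl_c w' = (q + 1) *: kl_c w'
      & forall P, KL_polynomials P -> KL_instance_right P s w w' w''].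
Proof.
move=> /exchange_second[s [ss dyckG ex cl [e e']]] Gw Gw' Gw''; exists s => //.
have [dG dG' dG''] := dyckG.
have {}ex := bruhat_exchange dyckG Gw Gw' Gw'' ex.
have lw : plen w = (plen w').+1 by rewrite (plen_associated Gw) (plen_associated Gw').
have lw' : plen w' = (plen w'').+1 by rewrite (plen_associated Gw') (plen_associated Gw'').
have sK : involutive ((@pmul n)^~ s) by move=> u; rewrite pmulsK.
have sN u := plen_simple_neq u ss.
have prod : kl_c w' * kl_c s = kl_c w + q *: kl_c w''.
  by rewrite (kl_c_mulr _ ss) !kl_cE (indicator_exchange q sK sN ex).
split=> // [|P KL].
  rewrite (kl_c_mull _ ss) !kl_cE indicator_closed // => u.
  by rewrite !(bruhat_graph_board _ dG' Gw').
have inv := bar_invariant_triple ss dyckG Gw Gw' Gw''.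
apply: (KLC_exchange ss sK sN _ _ ex lw lw' inv KL) => [u|u|].
- exact: plen_simple_ler.
- exact: bruhat_ltr.
- rewrite !KLC_kl_c //; try by apply: inv; rewrite !inE eqxx ?orbT.
  by rewrite -scalerAl -scalerAr prod scalerA addnC exprD invfM.
Qed.

End LeeProducts.

Theorem theorem6p1 (n : nat) (G G' G'' : rel 'I_n) (w w' w'' : 'S_n) :
  lee_triple G G' G'' ->
  associated G w -> associated G' w' -> associated G'' w'' ->
  [/\ exists s : 'S_n,
        [/\ simple_transp s,
            lee_first G G' G'' ->
              [/\ kl_c s * kl_c w' = kl_c w + q *: kl_c w'',
                  kl_c w' * kl_c s = (q + 1) *: kl_c w'
                & forall P, KL_polynomials P -> KL_instance_left P s w w' w'']
          & lee_second G G' G'' ->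
              [/\ kl_c w' * kl_c s = kl_c w + q *: kl_c w'',
                  kl_c s * kl_c w' = (q + 1) *: kl_c w'
                & forall P, KL_polynomials P -> KL_instance_right P s w w' w'']],
      forall tr : {linear hecke q n -> sym}, equivariant_trace tr ->
        (q + 1) *: tr (kl_c w') = tr (kl_c w) + q *: tr (kl_c w'')
    & forall m : {cmonom nat},
        (q + 1) * chromatic G' m = chromatic G m + q * chromatic G'' m].
Proof.
case=> lee Gw Gw' Gw''.
  have [s ss prod] := lee_first_product lee Gw Gw' Gw''.
  split=> [|tr [trC _]|m]; last exact: chromatic_first.
    exists s; split; [exact: ss | by move=> _; exact: prod |].
    by move=> /(lee_exclusive lee).
  (* Cyclicity gives (q + 1) tr(c_w') = tr(c_w' c_s) = tr(c_s c_w'). *)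
  by have [e1 e2 _] := prod; rewrite -linearZ -e2 -trC e1 linearD linearZ.
have [s ss prod] := lee_second_product lee Gw Gw' Gw''.
split=> [|tr [trC _]|m]; last exact: chromatic_second.
  exists s; split; [exact: ss | | by move=> _; exact: prod].
  by move=> /lee_exclusive/(_ lee).
by have [e1 e2 _] := prod; rewrite -linearZ -e2 -trC e1 linearD linearZ.
Qed.
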